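(* It holds true in $\mathbf{ZF}$ that a bornological universe $((X,\tau),\mathcal{B})$ is metrizable if and only if it is proper, while, simultaneously, the topological space $(X,\tau)$ is metrizable and $\mathcal{B}$ has a countable base.
   Context: The set theory is $\mathbf{ZF}$ (no choice). ''Countable'' means equipollent with a subset of $\omega$. A bornology in a set $X$ is a non-void ideal $\mathcal{B}$ of subsets of $X$ (closed under subsets and finite unions) containing every singleton of $X$. A base for $\mathcal{B}$ is a collection $\mathcal{A}\subseteq\mathcal{B}$ such that every member of $\mathcal{B}$ is a subset of a member of $\mathcal{A}$. A bornological universe is a pair $((X,\tau),\mathcal{B})$ where $(X,\tau)$ is a topological space and $\mathcal{B}$ is a bornology in $X$. It is proper if for each $A\in\mathcal{B}$ there is $B\in\mathcal{B}$ with $\mathrm{cl}_\tau A\subseteq\mathrm{int}_\tau B$. It is metrizable (in the sense of Hu) if there is a metric $d$ on $X$ such that $\tau=\tau(d)$ (the topology induced by $d$) and $\mathcal{B}=\{A\subseteq X:\mathrm{diam}_d(A)<+\infty\}$, where $\mathrm{diam}_d(A)=\sup\{d(x,y):x,y\in A\}$. *)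

(* Defs.v *)
(** "ZF proves S" is rendered semantically: S holds in every structure
    (V, ∈) that satisfies the first-order axioms of ZF.  All notions below are
    first-order over (V, ∈): every quantifier ranges over elements of V, i.e.
    over the sets of the model.  Consequently a choice principle assumed in the
    ambient logic yields no choice function inside V. *)

Set Implicit Arguments.
Unset Strict Implicit.
Unset Printing Implicit Defensive.

Record structure := Structure {
  sets :> Type;
  mem : sets -> sets -> Prop
}.

Declare Scope zf_scope.
Notation "x ∈ y" := (mem x y) (at level 70, no associativity) : zf_scope.
Open Scope zf_scope.

(** * First-order formulas in the language {∈, =}, with de Bruijn variables *)

Inductive formula :=
| fMem (i j : nat)
| fEq (i j : nat)
| fFalse
| fImp (p q : formula)
| fAll (p : formula).

Definition scons (V : Type) (x : V) (e : nat -> V) (n : nat) : V :=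
  match n with
  | O => x
  | S m => e m
  end.

Fixpoint sat (V : structure) (e : nat -> V) (p : formula) : Prop :=
  match p with
  | fMem i j => e i ∈ e j
  | fEq i j => e i = e j
  | fFalse => False
  | fImp p q => sat e p -> sat e q
  | fAll p => forall x : V, sat (scons x e) p
  end.

(** * Basic vocabulary *)

(* [a = {x | P x}] *)
Definition comprises (V : structure) (a : V) (P : V -> Prop) : Prop :=
  forall x : V, x ∈ a <-> P x.

Definition empty (V : structure) (a : V) : Prop :=
  forall x : V, ~ x ∈ a.

Definition subset (V : structure) (a b : V) : Prop :=
  forall x : V, x ∈ a -> x ∈ b.
Notation "a ⊆ b" := (subset a b) (at level 70, no associativity) : zf_scope.

Definition is_upair (V : structure) (p a b : V) : Prop :=
  comprises p (fun z => z = a \/ z = b).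

Definition is_singleton (V : structure) (s a : V) : Prop := is_upair s a a.

Definition is_cup (V : structure) (c a b : V) : Prop :=
  comprises c (fun z => z ∈ a \/ z ∈ b).

Definition is_cap (V : structure) (c a b : V) : Prop :=
  comprises c (fun z => z ∈ a /\ z ∈ b).

Definition is_diff (V : structure) (c a b : V) : Prop :=
  comprises c (fun z => z ∈ a /\ ~ z ∈ b).

Definition is_union (V : structure) (u a : V) : Prop :=
  comprises u (fun z => exists y, y ∈ a /\ z ∈ y).

Definition is_power (V : structure) (p a : V) : Prop :=
  comprises p (fun z => z ⊆ a).

(* [y = x ∪ {x}] *)
Definition is_succ (V : structure) (y x : V) : Prop :=
  comprises y (fun z => z ∈ x \/ z = x).

Definition inductive_set (V : structure) (w : V) : Prop :=
  (exists o, empty o /\ o ∈ w) /\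
  (forall x, x ∈ w -> exists y, is_succ y x /\ y ∈ w).

(** * The axioms of ZF *)

Record ZF (V : structure) : Prop := {
  zf_extensionality : forall a b : V, (forall x, x ∈ a <-> x ∈ b) -> a = b;
  zf_foundation : forall a : V, (exists x, x ∈ a) ->
    exists x, x ∈ a /\ forall y, y ∈ a -> ~ y ∈ x;
  zf_pairing : forall a b : V, exists p, is_upair p a b;
  zf_union : forall a : V, exists u, is_union u a;
  zf_power : forall a : V, exists p, is_power p a;
  zf_infinity : exists w : V, inductive_set w;
  zf_separation : forall (p : formula) (e : nat -> V) (a : V),
    exists b, comprises b (fun x => x ∈ a /\ sat (scons x e) p);
  zf_replacement : forall (p : formula) (e : nat -> V) (a : V),
    (forall x y z, x ∈ a ->
       sat (scons x (scons y e)) p -> sat (scons x (scons z e)) p -> y = z) ->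
    exists b, comprises b
      (fun y => exists x, x ∈ a /\ sat (scons x (scons y e)) p)
}.

(** * Pairs, relations, functions *)

(* Kuratowski: [p = {{a}, {a, b}}] *)
Definition is_pair (V : structure) (p a b : V) : Prop :=
  exists s t, is_singleton s a /\ is_upair t a b /\ is_upair p s t.

Definition is_prod (V : structure) (c a b : V) : Prop :=
  comprises c (fun p => exists x y, x ∈ a /\ y ∈ b /\ is_pair p x y).

(* [(x, y) ∈ r]; for a function [r], this says [r(x) = y] *)
Definition rel (V : structure) (r x y : V) : Prop :=
  exists p, is_pair p x y /\ p ∈ r.

Definition is_rel (V : structure) (r a b : V) : Prop :=
  exists c, is_prod c a b /\ r ⊆ c.

Definition is_fun (V : structure) (f a b : V) : Prop :=
  is_rel f a b /\ (forall x, x ∈ a -> exists! y, rel f x y).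

Definition is_bij (V : structure) (f a b : V) : Prop :=
  is_fun f a b /\ (forall y, y ∈ b -> exists! x, rel f x y).

(* [f : a × b -> c] *)
Definition is_fun2 (V : structure) (f a b c : V) : Prop :=
  exists ab, is_prod ab a b /\ is_fun f ab c.

(* [f(x, y) = z] *)
Definition rel2 (V : structure) (f x y z : V) : Prop :=
  exists p, is_pair p x y /\ rel f p z.

(** * Countability *)

Definition is_omega (V : structure) (w : V) : Prop :=
  inductive_set w /\ (forall u, inductive_set u -> w ⊆ u).

Definition countable (V : structure) (a : V) : Prop :=
  exists w s f, is_omega w /\ s ⊆ w /\ is_bij f a s.

(** * The real line of the model

    A complete ordered field inside V.  ZF proves that one exists and that any
    two are isomorphic, so fixing one amounts to fixing a construction of the
    reals.  [complete] quantifies over the subsets of [R] that belong to V. *)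

Record reals (V : structure) := Reals {
  R : V;
  zero : V;
  one : V;
  add : V;
  mul : V;
  leq : V
}.

Definition le (V : structure) (K : reals V) (x y : V) : Prop := rel (leq K) x y.
Definition lt (V : structure) (K : reals V) (x y : V) : Prop := le K x y /\ x <> y.

Definition is_upper_bound (V : structure) (K : reals V) (s b : V) : Prop :=
  b ∈ R K /\ (forall x, x ∈ s -> le K x b).

Definition is_sup (V : structure) (K : reals V) (s b : V) : Prop :=
  is_upper_bound K s b /\ (forall c, is_upper_bound K s c -> le K b c).

Record complete_ordered_field (V : structure) (K : reals V) : Prop := {
  zero_in : zero K ∈ R K;
  one_in : one K ∈ R K;
  add_fun : is_fun2 (add K) (R K) (R K) (R K);
  mul_fun : is_fun2 (mul K) (R K) (R K) (R K);
  le_rel : is_rel (leq K) (R K) (R K);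
  add_comm : forall x y s, rel2 (add K) x y s -> rel2 (add K) y x s;
  add_assoc : forall x y z u v w,
    rel2 (add K) x y u -> rel2 (add K) u z w ->
    rel2 (add K) y z v -> rel2 (add K) x v w;
  add_zero : forall x, x ∈ R K -> rel2 (add K) x (zero K) x;
  add_opp : forall x, x ∈ R K -> exists y, rel2 (add K) x y (zero K);
  mul_comm : forall x y s, rel2 (mul K) x y s -> rel2 (mul K) y x s;
  mul_assoc : forall x y z u v w,
    rel2 (mul K) x y u -> rel2 (mul K) u z w ->
    rel2 (mul K) y z v -> rel2 (mul K) x v w;
  mul_one : forall x, x ∈ R K -> rel2 (mul K) x (one K) x;
  mul_inv : forall x, x ∈ R K -> x <> zero K ->
    exists y, rel2 (mul K) x y (one K);
  mul_add : forall x y z s t u v,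
    rel2 (add K) y z s -> rel2 (mul K) x s t ->
    rel2 (mul K) x y u -> rel2 (mul K) x z v -> rel2 (add K) u v t;
  one_neq_zero : one K <> zero K;
  le_refl : forall x, x ∈ R K -> le K x x;
  le_antisym : forall x y, le K x y -> le K y x -> x = y;
  le_trans : forall x y z, le K x y -> le K y z -> le K x z;
  le_total : forall x y, x ∈ R K -> y ∈ R K -> le K x y \/ le K y x;
  le_add : forall x y z s t, le K x y ->
    rel2 (add K) x z s -> rel2 (add K) y z t -> le K s t;
  le_mul : forall x y s, le K (zero K) x -> le K (zero K) y ->
    rel2 (mul K) x y s -> le K (zero K) s;
  complete : forall s : V, s ⊆ R K -> (exists x, x ∈ s) ->
    (exists b, is_upper_bound K s b) -> exists b, is_sup K s b
}.

(** * Topological spaces *)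

Record topology (V : structure) (X T : V) : Prop := {
  top_sub : forall U, U ∈ T -> U ⊆ X;
  top_empty : forall o, empty o -> o ∈ T;
  top_full : X ∈ T;
  top_union : forall F U, F ⊆ T -> is_union U F -> U ∈ T;
  top_cap : forall U W I, U ∈ T -> W ∈ T -> is_cap I U W -> I ∈ T
}.

Definition closed (V : structure) (X T C : V) : Prop :=
  C ⊆ X /\ (forall U, is_diff U X C -> U ∈ T).

(* Intersection of the closed supersets. *)
Definition is_closure (V : structure) (X T c A : V) : Prop :=
  comprises c (fun x => x ∈ X /\
    (forall C, closed X T C -> A ⊆ C -> x ∈ C)).

(* Union of the open subsets. *)
Definition is_interior (V : structure) (T i A : V) : Prop :=
  comprises i (fun x => exists U, U ∈ T /\ U ⊆ A /\ x ∈ U).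

(** * Metrics *)

Record metric (V : structure) (K : reals V) (X d : V) : Prop := {
  metric_fun : is_fun2 d X X (R K);
  metric_ge0 : forall x y r, rel2 d x y r -> le K (zero K) r;
  metric_eq0 : forall x y, x ∈ X -> y ∈ X -> (rel2 d x y (zero K) <-> x = y);
  metric_sym : forall x y r, rel2 d x y r -> rel2 d y x r;
  metric_triangle : forall x y z r s t u,
    rel2 d x y r -> rel2 d y z s -> rel2 d x z t -> rel2 (add K) r s u ->
    le K t u
}.

Definition is_ball (V : structure) (K : reals V) (X d b x r : V) : Prop :=
  comprises b (fun y => y ∈ X /\ exists s, rel2 d x y s /\ lt K s r).

(* [T = τ(d)] *)
Definition induces_topology (V : structure) (K : reals V) (X d T : V) : Prop :=
  comprises T (fun U => U ⊆ X /\
    (forall x, x ∈ U -> exists r b, r ∈ R K /\ lt K (zero K) r /\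
       is_ball K X d b x r /\ b ⊆ U)).

(* The supremum is taken in [0, +∞], so that [diam ∅ = 0]; [is_diam] says that
   it is the real number [r], hence that it is finite. *)
Definition bounds_distances (V : structure) (K : reals V) (d A r : V) : Prop :=
  r ∈ R K /\ le K (zero K) r /\
  (forall x y s, x ∈ A -> y ∈ A -> rel2 d x y s -> le K s r).

Definition is_diam (V : structure) (K : reals V) (d A r : V) : Prop :=
  bounds_distances K d A r /\
  (forall r', bounds_distances K d A r' -> le K r r').

Definition finite_diam (V : structure) (K : reals V) (d A : V) : Prop :=
  exists r, is_diam K d A r.

Definition metrizable_space (V : structure) (K : reals V) (X T : V) : Prop :=
  exists d, metric K X d /\ induces_topology K X d T.

(** * Bornologies *)

Record bornology (V : structure) (X B : V) : Prop := {
  born_sub : forall A, A ∈ B -> A ⊆ X;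
  born_nonvoid : exists A, A ∈ B;
  born_down : forall A C, A ∈ B -> C ⊆ A -> C ∈ B;
  born_cup : forall A C U, A ∈ B -> C ∈ B -> is_cup U A C -> U ∈ B;
  born_singleton : forall x s, x ∈ X -> is_singleton s x -> s ∈ B
}.

Definition bornology_base (V : structure) (B A : V) : Prop :=
  A ⊆ B /\ (forall C, C ∈ B -> exists D, D ∈ A /\ C ⊆ D).

Definition has_countable_base (V : structure) (B : V) : Prop :=
  exists A, bornology_base B A /\ countable A.

Definition bornological_universe (V : structure) (X T B : V) : Prop :=
  topology X T /\ bornology X B.

Definition proper_universe (V : structure) (X T B : V) : Prop :=
  forall A, A ∈ B -> exists C c i,
    C ∈ B /\ is_closure X T c A /\ is_interior T i C /\ c ⊆ i.

(* Metrizability in the sense of Hu. *)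
Definition metrizable_universe (V : structure) (K : reals V) (X T B : V) : Prop :=
  exists d, metric K X d /\ induces_topology K X d T /\
    comprises B (fun A => A ⊆ X /\ finite_diam K d A).

(* Main.v *)
(** Separation and completeness of the reals are available in the model V only
    for predicates definable by first-order formulas with parameters, so each
    set, infimum and supremum requires a definability proof.

    If d is a metric whose bounded sets are B, the open 1-neighbourhood of a
    bounded set is bounded and contains its closure, and the balls of radius
    n around a fixed point form a countable base.

    Conversely let D be a metric inducing the topology.  An injection of a
    countable base into omega yields an increasing family (E r) of members of B,
    indexed by the reals r, that is cofinal in B.  By properness there is a
    monotone map s such that the closure of E (r + 1) lies in the interior of
    E (s r).  Let u r be the Urysohn function that is 0 on E r and 1 outside
    E (s r), the quotient of D(x, E r) by D(x, E r) + D(x, X \ E (s r)).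
    Then F x = sup (r * u r x) over r >= 0 is bounded exactly on the members
    of B.  By monotonicity the denominators are bounded below at each x uniformly
    in r, so the u r are equicontinuous and F is continuous.  The metric
    min(D(x, y), 1) + |F x - F y| induces the topology and its bounded sets are
    the members of B.  No choice is made: everything is defined by infima and
    suprema. *)

From HB Require Import structures.
From mathcomp Require Import all_boot all_order all_algebra boolp ring lra.
Require Import Defs.

Set Implicit Arguments.
Unset Strict Implicit.
Unset Printing Implicit Defensive.

Import Order.TTheory GRing.Theory Num.Theory.

Local Open Scope zf_scope.

(** * Elementary inequalities in real fields *)

Section RealFieldInequalities.
Local Open Scope ring_scope.

(** This estimate makes the Urysohn quotients Lipschitz with a constant that depends only on the
    lower bound [k] of the denominators. After [t / k] is lowered to [t / (a + b)] and the
    denominators are cleared, the inequality is the sum of [h1] and [h2]. *)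
Lemma ratio_lip (F : realFieldType) (a b a' b' t k : F) :
  0 < k -> 0 <= a' -> 0 <= b' -> k <= a + b -> k <= a' + b' ->
  a <= a' + t -> b' <= b + t -> 0 <= t ->
  a / (a + b) <= a' / (a' + b') + t / k.
Proof.
move=> k0 a0 b0 kab kab' aa bb t0.
have s0 : 0 < a + b by lra.
have s0' : 0 < a' + b' by lra.
apply: (@le_trans _ _ (a' / (a' + b') + t / (a + b))); last first.
  by rewrite lerD2l ler_wpM2l // lef_pV2 ?posrE.
rewrite -lerBlDr -mulrBl ler_pdivrMr // mulrAC ler_pdivlMr //.
have h1 : 0 <= (a' + t - a) * b' by rewrite mulr_ge0 //; lra.
have h2 : 0 <= a' * (b + t - b') by rewrite mulr_ge0 //; lra.
lra.
Qed.

Lemma small_radius (F : realFieldType) (m k e : F) :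
  0 <= m -> 0 < k -> 0 < e -> exists q, 0 < q /\ m * (q / k) < e.
Proof.
move=> m0 k0 e0; have m1 : 0 < m + 1 by lra.
(* Dividing by [m + 1] rather than [m] covers the case [m = 0]. *)
exists (e * k / (m + 1)); split; first by rewrite divr_gt0 ?mulr_gt0.
have -> : m * (e * k / (m + 1) / k) = e * m / (m + 1).
  by field; rewrite !gt_eqF.
by rewrite ltr_pdivrMr // ltr_pM2l //; lra.
Qed.

Lemma lt_minP (F : realFieldType) (a b c : F) :
  a < Num.min b c <-> a < b /\ a < c.
Proof. by rewrite lt_min; split=> /andP. Qed.

Lemma norm_sub_lt (F : realFieldType) (a b c e : F) :
  c < e -> b <= a + c -> a <= b + c -> `|a - b| < e.
Proof. by move=> ce ba ab; rewrite ltr_norml; apply/andP; split; lra. Qed.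

Lemma le_minP (F : realFieldType) (a b c : F) :
  a <= Num.min b c <-> a <= b /\ a <= c.
Proof. by rewrite le_min; split=> /andP. Qed.

Lemma min_add_norm_eq0 (F : realFieldType) (a u v : F) :
  0 <= a -> Num.min a 1 + `|u - v| = 0 -> a = 0.
Proof. by move=> a0; have := normr_ge0 (u - v); case: (lerP a 1); lra. Qed.

Lemma min_add_norm_triangle (F : realFieldType) (a b c u v w : F) :
  0 <= a -> 0 <= b -> c <= a + b ->
  Num.min c 1 + `|u - w| <= (Num.min a 1 + `|u - v|) + (Num.min b 1 + `|v - w|).
Proof.
move=> a0 b0 cab; have := ler_distD v u w.
by case: (lerP a 1); case: (lerP b 1); case: (lerP c 1); lra.
Qed.

Lemma min_add_lt (F : realFieldType) (a n r : F) :
  a < r / 2 -> n < r / 2 -> Num.min a 1 + n < r.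
Proof. by case: (lerP a 1); lra. Qed.

(** Capping the radius at 1 excludes the case [1 <= a], in which the truncated term alone would
    already be 1. *)
Lemma min_add_norm_lt (F : realFieldType) (a u v r : F) :
  Num.min a 1 + `|u - v| < Num.min r 1 -> a < r.
Proof.
by move=> /lt_minP []; have := normr_ge0 (u - v); case: (lerP a 1); lra.
Qed.

Lemma min_add_norm_le (F : realFieldType) (a u v r : F) :
  0 <= u -> 0 <= v -> u <= r -> v <= r -> Num.min a 1 + `|u - v| <= 1 + r.
Proof.
move=> u0 v0 ur vr; have : `|u - v| <= r by rewrite ler_norml; apply/andP; split; lra.
by case: (lerP a 1); lra.
Qed.

Lemma min_add_norm_ge (F : realFieldType) (a u v r : F) :
  0 <= a -> Num.min a 1 + `|u - v| <= r -> u <= v + r.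
Proof. by move=> a0; have := ler_norm (u - v); case: (lerP a 1); lra. Qed.

End RealFieldInequalities.

(** * Definable predicates *)

Section Definability.
Variable V : structure.
Implicit Types (e : nat -> V) (p : formula) (P Q : (nat -> V) -> Prop)
  (t : (nat -> V) -> V).

Notation shift e := (fun i => e (S i)).

Fixpoint rename (r : nat -> nat) p : formula :=
  match p with
  | fMem i j => fMem (r i) (r j)
  | fEq i j => fEq (r i) (r j)
  | fFalse => fFalse
  | fImp p q => fImp (rename r p) (rename r q)
  | fAll p => fAll (rename (fun i => if i is S j then S (r j) else O) p)
  end.

Lemma sat_rename p r e : sat e (rename r p) <-> sat (fun i => e (r i)) p.
Proof.
elim: p r e => [i j|i j||p IHp q IHq|p IHp] r e //=.
  by rewrite IHp IHq.
split=> H x; have := H x; rewrite IHp.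
  by congr sat; apply/funext; case.
by congr sat; apply/funext; case.
Qed.

(* An assignment of variables ([inl]) and parameters ([inr]) to the free
   variables of a formula. *)
Definition instantiate (g : nat -> nat + V) e (i : nat) : V :=
  match g i with inl j => e j | inr v => v end.

(** The predicate takes a whole environment, so that binding a variable is a shift. One formula and
    one assignment of parameters must serve all environments. *)
Definition definable P : Prop :=
  exists p g, forall e, sat (instantiate g e) p <-> P e.

(** The language has no function symbols, so a term is represented by its graph: variable 0 holds
    the value and the arguments move up by one. *)
Definition definable_term t : Prop :=
  definable (fun e => e 0 = t (shift e)).

Lemma definable_ext P Q : (forall e, P e <-> Q e) -> definable P -> definable Q.
Proof. by move=> PQ; have -> : Q = P by apply/funext => e; apply/propext; rewrite PQ. Qed.

Lemma definable_subst P (h : nat -> nat + V) :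
  definable P -> definable (fun e => P (instantiate h e)).
Proof.
case=> p [g H]; exists p.
exists (fun i => match g i with inl j => h j | inr v => inr v end) => e.
rewrite -H /instantiate; set u := fun i : nat => _; set v := fun i : nat => _.
suff -> : u = v by [].
by apply/funext => i; rewrite /u /v; case: (g i).
Qed.

Lemma definable_mem_var i j : definable (fun e => e i ∈ e j).
Proof. by exists (fMem i j), inl. Qed.

Lemma definable_eq_var i j : definable (fun e => e i = e j).
Proof. by exists (fEq i j), inl. Qed.

Lemma definable_False : definable (fun _ => False).
Proof. by exists fFalse, inl. Qed.

Lemma definable_imp P Q :
  definable P -> definable Q -> definable (fun e => P e -> Q e).
Proof.
move=> [p [g Hp]] [q [h Hq]].
(* The two formulas carry unrelated assignments. Moving the variables of [p] to even indices and
   those of [q] to odd ones lets a single assignment serve both. *)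
exists (fImp (rename double p) (rename (fun i => i.*2.+1) q)).
exists (fun i => if odd i then h i./2 else g i./2) => e /=.
rewrite !sat_rename -Hp -Hq /instantiate.
have -> : (fun i => match (if odd i.*2 then h i.*2./2 else g i.*2./2) with
   | inl j => e j | inr v => v end)
  = (fun i => match g i with inl j => e j | inr v => v end).
  by apply/funext => i; rewrite odd_double doubleK.
suff -> : (fun i => match
   (if odd i.*2.+1 then h i.*2.+1./2 else g i.*2.+1./2) with
   | inl j => e j | inr v => v end)
  = (fun i => match h i with inl j => e j | inr v => v end) by [].
by apply/funext => i; rewrite oddS odd_double /= uphalf_double.
Qed.

Lemma definable_forall (Q : (nat -> V) -> V -> Prop) :
  definable (fun e => Q (shift e) (e 0)) -> definable (fun e => forall x, Q e x).
Proof.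
move=> [p [g H]].
(* Several free variables of [p] may stand for the quantified element; all of them are merged into
   the bound index 0, and every other index moves up past the binder. *)
exists (fAll (rename (fun i => if g i is inl O then O else S i) p)).
exists (fun i => match g i with inl (S j) => inl j | inl O => inl O | inr v => inr v end).
move=> e /=; suff E x : sat (scons x (instantiate (fun i => match g i with
   | inl 0 => inl 0 | inl j.+1 => inl j | inr v => inr v end) e))
   (rename (fun i => match g i with inl 0 => 0 | _ => i.+1 end) p) <-> Q e x.
  by split=> K x; apply/E.
rewrite sat_rename -(H (scons x e)) /instantiate.
set u := fun i : nat => _; set v := fun i : nat => _.
suff -> : u = v by [].
by apply/funext => i; rewrite /u /v; case gi: (g i) => [[|j]|w] /=; rewrite ?gi.
Qed.

Lemma definable_not P : definable P -> definable (fun e => ~ P e).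
Proof. by move=> dP; exact: definable_imp dP definable_False. Qed.

Lemma definable_and P Q :
  definable P -> definable Q -> definable (fun e => P e /\ Q e).
Proof.
move=> dP dQ.
have := definable_not (definable_imp dP (definable_not dQ)).
apply: definable_ext => e; split=> [H|[p q] H]; last exact: H.
by split; apply: contrapT => H'; apply: H => ? ?.
Qed.

Lemma definable_or P Q :
  definable P -> definable Q -> definable (fun e => P e \/ Q e).
Proof.
move=> dP dQ; have := definable_imp (definable_not dP) dQ.
apply: definable_ext => e; split=> [H|[|] //].
by case: (lem (P e)) => [|/H]; [left|right].
Qed.

Lemma definable_iff P Q :
  definable P -> definable Q -> definable (fun e => P e <-> Q e).
Proof. by move=> dP dQ; apply: definable_and; apply: definable_imp. Qed.

Lemma definable_exists (Q : (nat -> V) -> V -> Prop) :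
  definable (fun e => Q (shift e) (e 0)) -> definable (fun e => exists x, Q e x).
Proof.
move=> dQ.
have := definable_not (definable_forall (Q := fun e x => ~ Q e x) (definable_not dQ)).
apply: definable_ext => e; split=> [H|[x Qx] H]; last exact: H Qx.
by apply: contrapT => H'; apply: H => x Qx; apply: H'; exists x.
Qed.

(** Substitution of a term goes through its graph: [Q e (t e)] holds iff some [x] equals [t e] and
    satisfies [Q e x]. *)
Lemma definable_at t (Q : (nat -> V) -> V -> Prop) :
  definable_term t -> definable (fun e => Q (shift e) (e 0)) ->
  definable (fun e => Q e (t e)).
Proof.
move=> dt dQ; have := definable_exists (Q := fun e x => x = t e /\ Q e x)
  (definable_and dt dQ).
apply: definable_ext => e; split=> [[x [-> //]]|H].
by exists (t e).
Qed.

Lemma definable_term_var i : definable_term (fun e => e i).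
Proof. exact: definable_eq_var. Qed.

Lemma definable_term_const v : definable_term (fun=> v).
Proof.
exact: (definable_subst (fun i => if i is O then inl O else inr v)
  (definable_eq_var 0 1)).
Qed.

Lemma definable_term_shift t :
  definable_term t -> definable_term (fun e => t (shift e)).
Proof.
exact: (definable_subst (fun i => if i is S j then inl j.+2 else inl O)).
Qed.

(** Inserts a dummy variable just above variable 0, as is needed when a definable predicate is used
    below one more binder. *)
Lemma definable_weaken (Q : (nat -> V) -> V -> Prop) :
  definable (fun e => Q (shift e) (e 0)) ->
  definable (fun e => Q (shift (shift e)) (e 0)).
Proof.
exact: (definable_subst (fun i => if i is S j then inl j.+2 else inl O)).
Qed.

Lemma definable_mem s t :
  definable_term s -> definable_term t -> definable (fun e => s e ∈ t e).
Proof.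
move=> ds dt; apply: (definable_at (Q := fun e x => x ∈ t e)) => //.
apply: (definable_at (Q := fun e x => e 0 ∈ x)).
  exact: definable_term_shift.
exact: definable_mem_var.
Qed.

Lemma definable_eq s t :
  definable_term s -> definable_term t -> definable (fun e => s e = t e).
Proof. by move=> ds dt; apply: (definable_at (Q := fun e x => x = t e)). Qed.

(** Closure under substitution of terms is built in, because the proof search applies it in this
    form; [definable_funE] reduces it to the case of a variable. *)
Definition definable_fun (F : V -> V) : Prop :=
  forall t, definable_term t -> definable_term (fun e => F (t e)).

Lemma definable_funE (F : V -> V) :
  definable_term (fun e => F (e 0)) -> definable_fun F.
Proof.
move=> dF t dt; apply: (@definable_at (fun e => t (shift e)) (fun e x => e 0 = F x)).
  exact: definable_term_shift.
exact: (definable_subst (fun i => inl (if i is 0 then 1 else 0)) dF).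
Qed.

Definition definable_fun2 (F : V -> V -> V) : Prop :=
  forall s t, definable_term s -> definable_term t ->
    definable_term (fun e => F (s e) (t e)).

Lemma definable_fun2E (F : V -> V -> V) :
  definable_term (fun e => F (e 1) (e 0)) -> definable_fun2 F.
Proof.
move=> dF s t ds dt.
apply: (@definable_at (fun e => t (shift e)) (fun e y => e 0 = F (s (shift e)) y)).
  exact: definable_term_shift.
apply: (@definable_at (fun e => s (shift (shift e))) (fun e x => e 1 = F x (e 0))).
  exact: (definable_term_shift (definable_term_shift ds)).
(* The two substitutions have left the value at index 2 and the first argument at index 0; [2 - i]
   exchanges them and fixes the second argument at index 1. *)
exact: (definable_subst (fun i => inl (2 - i)) dF).
Qed.

End Definability.

(* Definability is decided by structural decomposition; each new set operation
   declares a hint. *)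
Create HintDb definable.
Ltac definability := solve [auto 200 with definable nocore].

#[export] Hint Extern 0 (definable (fun=> False)) =>
  apply: definable_False : definable.
#[export] Hint Extern 1 (definable (fun e => @?P e -> @?Q e)) =>
  apply: (@definable_imp _ P Q); cbv beta : definable.
#[export] Hint Extern 1 (definable (fun e => @?P e /\ @?Q e)) =>
  apply: (@definable_and _ P Q); cbv beta : definable.
#[export] Hint Extern 1 (definable (fun e => @?P e \/ @?Q e)) =>
  apply: (@definable_or _ P Q); cbv beta : definable.
#[export] Hint Extern 1 (definable (fun e => @?P e <-> @?Q e)) =>
  apply: (@definable_iff _ P Q); cbv beta : definable.
#[export] Hint Extern 1 (definable (fun e => ~ @?P e)) =>
  apply: (@definable_not _ P); cbv beta : definable.
#[export] Hint Extern 1 (definable (fun e => @?s e ∈ @?t e)) =>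
  apply: (@definable_mem _ s t); cbv beta : definable.
#[export] Hint Extern 1 (definable (fun e => @?s e = @?t e :> sets _)) =>
  apply: (@definable_eq _ s t); cbv beta : definable.
#[export] Hint Extern 1 (definable (fun e => forall x : sets _, @?Q e x)) =>
  apply: (@definable_forall _ Q); cbv beta : definable.
#[export] Hint Extern 1 (definable (fun e => exists x : sets _, @?Q e x)) =>
  apply: (@definable_exists _ Q); cbv beta : definable.
#[export] Hint Extern 0 (definable_term (fun e => e _)) =>
  apply: definable_term_var : definable.
#[export] Hint Extern 0 (definable_term (fun _ => _)) =>
  apply: definable_term_const : definable.
#[export] Hint Extern 2 (definable (fun e => subset (@?s e) (@?t e))) =>
  unfold subset; cbv beta : definable.
#[export] Hint Extern 2 (definable_term (fun e => ?F (@?t e))) =>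
  match goal with H : definable_fun F |- _ => apply: (H t); cbv beta end : definable.
#[export] Hint Extern 2 (definable_term (fun e => ?F (@?s e) (@?t e))) =>
  match goal with H : definable_fun2 F |- _ => apply: (H s t); cbv beta end : definable.
#[export] Hint Extern 2 (definable_term (fun e => ?f (?F (@?t e)))) =>
  match goal with H : definable_fun (fun x => f (F x)) |- _ =>
    apply: (H t); cbv beta
  end : definable.
#[export] Hint Extern 2 (definable_term (fun e => ?f (?F (@?s e) (@?t e)))) =>
  match goal with H : definable_fun2 (fun x y => f (F x y)) |- _ =>
    apply: (H s t); cbv beta
  end : definable.

(** * Definite descriptions and the basic set operations *)

Section Model.
Variables (V : structure) (hV : ZF V).
Implicit Types (a b c d f p u w x y z : V) (s t : (nat -> V) -> V) (P Q : V -> Prop).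

Notation shift e := (fun i => e (S i)).

Lemma set_ext a b : (forall x, x ∈ a <-> x ∈ b) -> a = b.
Proof. exact: (zf_extensionality hV). Qed.

Lemma subset_antisym a b : a ⊆ b -> b ⊆ a -> a = b.
Proof. by move=> ab ba; apply: set_ext => x; split=> [/ab|/ba]. Qed.

Lemma comprises_unique a (P : V -> Prop) : comprises a P ->
  exists! b, comprises b P.
Proof. by move=> H; exists a; split=> // b Hb; apply: set_ext => x; rewrite H Hb. Qed.

Lemma model_inhabited : exists x : V, True.
Proof. by have [w _] := zf_infinity hV; exists w. Qed.

(* Definite description is obtained from an opaque existence proof, so that
   unification never unfolds it. *)
Lemma the_exists : exists F : (V -> Prop) -> V,
  (forall P, (exists! x, P x) -> P (F P)) /\
  exists d, forall P, ~ (exists! x, P x) -> F P = d.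
Proof.
have [d _] := model_inhabited.
exists (fun P => match pselect (exists! x, P x) with
  | left H => sval (cid H) | right _ => d end); split=> [P|].
  by case: pselect => // H _; case: (cid H) => x [].
by exists d => P; case: pselect.
Qed.

Definition the : (V -> Prop) -> V := sval (cid the_exists).

Lemma theP (P : V -> Prop) : (exists! x, P x) -> P (the P).
Proof. by rewrite /the; case: (cid _) => F [H _] /=; exact: H. Qed.

Lemma the_default : exists d, forall P : V -> Prop, ~ (exists! x, P x) -> the P = d.
Proof. by rewrite /the; case: (cid _) => F []. Qed.

(** Where the description fails, [the] has the constant value [d], which enters the formula as a
    parameter. Hence no proof of unique existence is needed for definability. *)
Lemma definable_the (P : (nat -> V) -> V -> Prop) :
  definable (fun e => P (shift e) (e 0)) -> definable_term (fun e => the (P e)).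
Proof.
move=> dP; have [d Hd] := the_default; rewrite /definable_term.
apply: (@definable_ext _ (fun e =>
  (P (shift e) (e 0) /\ (forall y, P (shift e) y -> e 0 = y)) \/
  (~ (exists x, P (shift e) x /\ (forall y, P (shift e) y -> x = y)) /\ e 0 = d))).
  move=> e; case: (lem (exists! x, P (shift e) x)) => [H|nH].
    have Pt := theP H; have [x [_ ux]] := H.
    split=> [[[_ uy]|[[]]//]|->]; first exact: uy.
    by left; split=> // y Py; rewrite -(ux y Py); apply/esym/ux.
  rewrite Hd //; split=> [[H|[]//]|->]; last by right.
  by case: nH; exists (e 0).
have dP1 := definable_weaken dP.
have dP2 := definable_weaken (Q := fun e => P (shift e)) dP1.
definability.
Qed.

Hint Extern 1 (definable_term (fun e => the (@?P e))) =>
  apply: (@definable_the P); cbv beta : definable.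

Definition sep a (P : V -> Prop) : V :=
  the (fun b => comprises b (fun x => x ∈ a /\ P x)).

Lemma mem_sep a (P : V -> Prop) x :
  definable (fun e => P (e 0)) -> x ∈ sep a P <-> x ∈ a /\ P x.
Proof.
move=> [p [g H]].
(* The predicate depends on variable 0 only, so it may be evaluated in a constant environment: all
   variables collapse to the separated element, and the parameters fill the environment of the
   axiom. *)
have [b Hb] := zf_separation hV
  (rename (fun i => if g i is inl _ then O else S i) p)
  (fun i => if g i is inr v then v else a) a.
have /comprises_unique/theP : comprises b (fun x => x ∈ a /\ P x).
  move=> y; rewrite Hb sat_rename -(H (fun=> y)) /instantiate.
  set u := fun i : nat => _; set v := fun i : nat => _.
  suff -> : u = v by [].
  by apply/funext => i; rewrite /u /v; case gi: (g i) => [j|w] /=; rewrite ?gi.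
exact.
Qed.

Lemma definable_sep (t : (nat -> V) -> V) (P : (nat -> V) -> V -> Prop) :
  definable_term t -> definable (fun e => P (shift e) (e 0)) ->
  definable_term (fun e => sep (t e) (P e)).
Proof.
move=> dt dP; apply: definable_the; rewrite /comprises.
have dP1 := definable_weaken dP.
have dt1 := definable_term_shift dt.
have dt2 := definable_term_shift dt1.
by definability.
Qed.
Hint Extern 1 (definable_term (fun e => sep (@?t e) (@?P e))) =>
  apply: (@definable_sep t P); cbv beta : definable.

Definition upair a b := the (fun p => is_upair p a b).
Definition bigcup a := the (fun u => is_union u a).
Definition pow a := the (fun p => is_power p a).

Lemma in_upair a b x : x ∈ upair a b <-> x = a \/ x = b.
Proof. by have [p /comprises_unique/theP] := zf_pairing hV a b; apply. Qed.

Lemma in_bigcup a x : x ∈ bigcup a <-> exists y, y ∈ a /\ x ∈ y.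
Proof. by have [p /comprises_unique/theP] := zf_union hV a; apply. Qed.

Lemma in_pow a x : x ∈ pow a <-> x ⊆ a.
Proof. by have [p /comprises_unique/theP] := zf_power hV a; apply. Qed.

#[local] Opaque the sep.

Lemma definable_upair s t : definable_term s -> definable_term t ->
  definable_term (fun e => upair (s e) (t e)).
Proof.
rewrite /upair=> ds dt; apply: definable_the; rewrite /is_upair /comprises.
have ds2 := definable_term_shift (definable_term_shift ds).
have dt2 := definable_term_shift (definable_term_shift dt).
definability.
Qed.
Hint Extern 1 (definable_term (fun e => upair (@?s e) (@?t e))) =>
  apply: (@definable_upair s t); cbv beta : definable.

Lemma definable_bigcup t : definable_term t ->
  definable_term (fun e => bigcup (t e)).
Proof.
move=> dt; apply: definable_the; rewrite /is_union /comprises.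
have dt2 := definable_term_shift (definable_term_shift (definable_term_shift dt)).
definability.
Qed.
Hint Extern 1 (definable_term (fun e => bigcup (@?t e))) =>
  apply: (@definable_bigcup t); cbv beta : definable.

Lemma definable_pow t : definable_term t -> definable_term (fun e => pow (t e)).
Proof.
move=> dt; apply: definable_the; rewrite /is_power /comprises.
have dt1 := definable_term_shift (definable_term_shift dt).
have dt2 := definable_term_shift dt1.
definability.
Qed.
Hint Extern 1 (definable_term (fun e => pow (@?t e))) =>
  apply: (@definable_pow t); cbv beta : definable.

#[local] Opaque upair bigcup pow.

Definition pair a b := upair (upair a a) (upair a b).
Definition cup a b := bigcup (upair a b).
Definition void := sep (sval (cid model_inhabited)) (fun=> False).
Definition succ x := cup x (upair x x).
Definition cprod a b :=
  sep (pow (pow (cup a b))) (fun p => exists x y, x ∈ a /\ y ∈ b /\ p = pair x y).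

Lemma definable_pair s t : definable_term s -> definable_term t ->
  definable_term (fun e => pair (s e) (t e)).
Proof. by rewrite /pair => ds dt; definability. Qed.
Hint Extern 1 (definable_term (fun e => pair (@?s e) (@?t e))) =>
  apply: (@definable_pair s t); cbv beta : definable.

Lemma definable_cup s t : definable_term s -> definable_term t ->
  definable_term (fun e => cup (s e) (t e)).
Proof. by rewrite /cup => ds dt; definability. Qed.
Hint Extern 1 (definable_term (fun e => cup (@?s e) (@?t e))) =>
  apply: (@definable_cup s t); cbv beta : definable.

Lemma definable_succ t : definable_term t -> definable_term (fun e => succ (t e)).
Proof. by rewrite /succ => dt; definability. Qed.
Hint Extern 1 (definable_term (fun e => succ (@?t e))) =>
  apply: (@definable_succ t); cbv beta : definable.

Lemma definable_cprod s t : definable_term s -> definable_term t ->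
  definable_term (fun e => cprod (s e) (t e)).
Proof.
rewrite /cprod => ds dt.
have ds3 := definable_term_shift (definable_term_shift (definable_term_shift ds)).
have dt3 := definable_term_shift (definable_term_shift (definable_term_shift dt)).
definability.
Qed.
Hint Extern 1 (definable_term (fun e => cprod (@?s e) (@?t e))) =>
  apply: (@definable_cprod s t); cbv beta : definable.

Lemma in_cup a b x : x ∈ cup a b <-> x ∈ a \/ x ∈ b.
Proof.
rewrite in_bigcup; split=> [[y []]|].
  by rewrite in_upair => -[] -> ?; [left|right].
by case=> ?; [exists a|exists b]; split=> //; apply/in_upair; [left|right].
Qed.

Lemma in_void x : ~ x ∈ void.
Proof. by rewrite mem_sep; [case|definability]. Qed.

#[local] Opaque void cup.

Lemma empty_void o : empty o <-> o = void.
Proof.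
split=> [H|->]; last exact: in_void.
by apply: set_ext => x; split=> [/H|/in_void].
Qed.

Lemma in_succ x y : y ∈ succ x <-> y ∈ x \/ y = x.
Proof. by rewrite in_cup in_upair; split=> -[]; [left|case|left|]; auto. Qed.

#[local] Opaque succ.

Lemma upair_eq a b c d : upair a b = upair c d ->
  (a = c /\ b = d) \/ (a = d /\ b = c).
Proof.
move=> H.
have := in_upair c d a; have := in_upair c d b.
rewrite -H !in_upair => -[/(_ (or_intror erefl)) Hb _] [/(_ (or_introl erefl)) Ha _].
have := in_upair a b c; have := in_upair a b d.
rewrite H !in_upair => -[/(_ (or_intror erefl)) Hd _] [/(_ (or_introl erefl)) Hc _].
by case: Ha Hb Hc Hd => -> [] -> []  ? [] ?; subst; auto.
Qed.

Lemma pair_inj a b c d : pair a b = pair c d -> a = c /\ b = d.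
Proof.
case/upair_eq => -[]; first by move=> /upair_eq[] [-> _] /upair_eq[] [] *; subst.
by move=> /upair_eq[] [-> ->] /upair_eq[] [] *; subst.
Qed.

Lemma is_upairE p a b : is_upair p a b <-> p = upair a b.
Proof.
split=> [H|->]; last by move=> x; rewrite in_upair.
by apply: set_ext => x; rewrite H in_upair.
Qed.

Lemma is_pairE p a b : is_pair p a b <-> p = pair a b.
Proof.
rewrite /pair; split=> [[x [y []]]|->]; rewrite /is_singleton.
  by rewrite !is_upairE => -> [-> ->].
by exists (upair a a), (upair a b); rewrite /is_singleton !is_upairE.
Qed.

#[local] Opaque pair.

Lemma in_cprod a b p :
  p ∈ cprod a b <-> exists x y, x ∈ a /\ y ∈ b /\ p = pair x y.
Proof.
rewrite mem_sep; last definability.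
split=> [[]//|[x [y [xa [yb ->]]]]]; split; last by exists x, y.
rewrite in_pow => u /in_upair uE; rewrite in_pow => z.
by rewrite in_cup; case: uE => ->; rewrite in_upair => -[] ->; [left|left|left|right].
Qed.

#[local] Opaque cprod.

Lemma pair_in_cprod a b x y : pair x y ∈ cprod a b <-> x ∈ a /\ y ∈ b.
Proof.
rewrite in_cprod; split=> [[x' [y' [xa [yb /pair_inj[-> ->]]]]] //|[xa yb]].
by exists x, y.
Qed.

Lemma is_prodE c a b : is_prod c a b <-> c = cprod a b.
Proof.
split=> [H|->].
  apply: set_ext => p; rewrite H in_cprod.
  by split=> -[x [y [xa [yb]]]] /is_pairE; exists x, y.
by move=> p; rewrite in_cprod; split=> -[x [y [xa [yb]]]] /is_pairE; exists x, y.
Qed.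

Lemma relE f x y : rel f x y <-> pair x y ∈ f.
Proof.
split=> [[p [/is_pairE ->]] //|H].
by exists (pair x y); split=> //; apply/is_pairE.
Qed.

Lemma rel2E f x y z : rel2 f x y z <-> pair (pair x y) z ∈ f.
Proof.
rewrite -relE; split=> [[p [/is_pairE ->]] //|H].
by exists (pair x y); split=> //; apply/is_pairE.
Qed.

Lemma is_relE f a b : is_rel f a b <-> f ⊆ cprod a b.
Proof.
split=> [[c [/is_prodE ->]] //|H].
by exists (cprod a b); split=> //; apply/is_prodE.
Qed.

Lemma is_funE f a b : is_fun f a b <->
  f ⊆ cprod a b /\ forall x, x ∈ a -> exists! y, pair x y ∈ f.
Proof.
rewrite /is_fun is_relE; split=> -[fab H]; split=> // x /H [y [Hy uy]];
  exists y; split; try (by apply/relE).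
  by move=> z /relE /uy.
by move=> z /relE /uy.
Qed.

Lemma is_fun2E f a b c : is_fun2 f a b c <->
  (forall x y z, rel2 f x y z -> x ∈ a /\ y ∈ b /\ z ∈ c) /\
  (forall x y, x ∈ a -> y ∈ b -> exists! z, rel2 f x y z) /\
  f ⊆ cprod (cprod a b) c.
Proof.
split=> [[ab [/is_prodE ->]] /is_funE [fs ff]|[H1 [H2 H3]]].
  split; last split=> //.
    by move=> x y z /rel2E/fs; rewrite !pair_in_cprod => -[[]].
  move=> x y xa yb; have /ff : pair x y ∈ cprod a b by apply/pair_in_cprod.
  move=> [z [Hz uz]]; exists z; split; first exact/rel2E.
  by move=> w /rel2E/uz.
exists (cprod a b); rewrite is_prodE is_funE; split=> //; split=> // p.
rewrite in_cprod => -[x [y [xa [yb ->]]]]; have [z [/rel2E Hz uz]] := H2 _ _ xa yb.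
by exists z; split=> // w /rel2E/uz.
Qed.

(** * The set omega *)

(** Foundation applied to the pair of [x] and [y]. *)
Lemma mem_asym x y : x ∈ y -> ~ y ∈ x.
Proof.
move=> xy yx; have [z [/in_upair]] : exists z, z ∈ upair x y /\
    forall u, u ∈ upair x y -> ~ u ∈ z.
  by apply: (zf_foundation hV); exists x; apply/in_upair; left.
by case=> -> /[dup] /(_ x) H /(_ y) H'; [apply: H'|apply: H] => //;
   apply/in_upair; [right|left].
Qed.

Lemma succ_inj x y : succ x = succ y -> x = y.
Proof.
move=> H.
have /in_succ [xy|//] : x ∈ succ y by rewrite -H; apply/in_succ; right.
have /in_succ [yx|//] : y ∈ succ x by rewrite H; apply/in_succ; right.
by case: (mem_asym xy).
Qed.

Lemma succ_neq_void x : succ x <> void.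
Proof.
by move=> H; have /in_void [] : x ∈ void; rewrite -H; apply/in_succ; right.
Qed.

Lemma inductive_setE w :
  inductive_set w <-> void ∈ w /\ forall x, x ∈ w -> succ x ∈ w.
Proof.
have is_succE x y : is_succ y x <-> y = succ x.
  split=> [H|->]; last by move=> z; rewrite in_succ.
  by apply: set_ext => z; rewrite H in_succ.
split=> [[[o [/empty_void ->]] ow H]|[ow H]]; split=> //.
- by move=> x /H [y [/is_succE ->]].
- by exists void; split=> //; apply/empty_void.
- by move=> x /H xw; exists (succ x); split=> //; apply/is_succE.
Qed.

Lemma omega_exists : exists w, is_omega w.
Proof.
have [w wI] := zf_infinity hV.
pose u := sep w (fun n =>
  forall u, void ∈ u /\ (forall x, x ∈ u -> succ x ∈ u) -> n ∈ u).
have inu n : n ∈ u <-> forall u, inductive_set u -> n ∈ u.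
  rewrite mem_sep; last by definability.
  split=> [[nw H] v /inductive_setE vI|H]; first exact: H.
  by split=> [|v vI]; apply: H => //; apply/inductive_setE.
exists u; split; last by move=> v vI n /inu; apply.
apply/inductive_setE; split=> [|x /inu H]; apply/inu => v vI.
  by case/inductive_setE: vI.
by have /inductive_setE [_] := vI; apply; apply: H.
Qed.

Definition omega := sval (cid omega_exists).

Lemma is_omega_omega : is_omega omega.
Proof. by rewrite /omega; case: (cid _). Qed.

Lemma is_omegaE w : is_omega w <-> w = omega.
Proof.
have [oI oM] := is_omega_omega.
split=> [[wI H]|->]; last exact: is_omega_omega.
by apply: subset_antisym; [apply: H|apply: oM].
Qed.

Lemma void_omega : void ∈ omega.
Proof. by have [/inductive_setE []] := is_omega_omega. Qed.

Lemma succ_omega x : x ∈ omega -> succ x ∈ omega.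
Proof. by have [/inductive_setE [_ H] _] := is_omega_omega; apply: H. Qed.

(** Definability makes the elements of [omega] satisfying [P] a set of the model, and that set is
    inductive. Every induction below therefore starts with a definability goal. *)
Lemma omega_ind P : definable (fun e => P (e 0)) ->
  P void -> (forall x, x ∈ omega -> P x -> P (succ x)) ->
  forall x, x ∈ omega -> P x.
Proof.
move=> dP P0 PS x xw.
suff : x ∈ sep omega P by rewrite mem_sep // => -[].
have [_] := is_omega_omega; apply; last exact: xw.
apply/inductive_setE; rewrite mem_sep //; split; first by split=> //; exact: void_omega.
by move=> y; rewrite !mem_sep // => -[yw Py]; split; [exact: succ_omega|exact: PS].
Qed.

Lemma omega_trans x y : x ∈ omega -> y ∈ x -> y ∈ omega.
Proof.
move=> xw; move: x xw y; apply: omega_ind; first by definability.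
  by move=> y /in_void.
by move=> x xw IH y /in_succ [/IH|->].
Qed.

Lemma omega_total x y : x ∈ omega -> y ∈ omega -> x ∈ y \/ x = y \/ y ∈ x.
Proof.
move=> xw; move: x xw y; apply: omega_ind; first by definability.
  apply: omega_ind; first by definability.
    by right; left.
  by move=> x _ [H|[->|/in_void//]]; left; apply/in_succ; [left|right].
(* Below [y], a successor either stays below [y] or reaches it; this is what the successor case of
   the outer induction needs. *)
have succ_mem x : x ∈ omega -> forall y, y ∈ omega -> x ∈ y -> succ x ∈ y \/ succ x = y.
  move=> xw; apply: omega_ind; first by definability.
    by move=> /in_void.
  move=> y _ IH /in_succ [/IH [H|<-]|->]; last by right.
    by left; apply/in_succ; left.
  by left; apply/in_succ; right.
move=> x xw IH y yw; case: (IH y yw) => [/(succ_mem x xw y yw)|[<-|yx]].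
- by case; [left|right; left].
- by right; right; apply/in_succ; right.
- by right; right; apply/in_succ; left.
Qed.

(** Foundation gives a member of the separated set that is minimal for membership, and transitivity
    of [omega] makes it least in the required sense. *)
Lemma omega_least P : definable (fun e => P (e 0)) ->
  (exists x, x ∈ omega /\ P x) ->
  exists x, x ∈ omega /\ P x /\ forall y, y ∈ x -> ~ P y.
Proof.
move=> dP [x [xw Px]].
have [|y [/mem_sep]] := zf_foundation hV (a := sep omega P).
  by exists x; rewrite mem_sep.
case=> // yw Py H; exists y; split=> //; split=> // z zy Pz.
by apply: (H z) => //; rewrite mem_sep //; split=> //; apply: omega_trans zy.
Qed.

(** * The real line of the model as a real field *)

Variables (K : reals V) (hK : complete_ordered_field K).

(** Packing the elements of [R K] into a type makes the algebraic hierarchy, and with it [lra],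
    available for the reals of the model. *)
Record real := Real { rval : V; rvalP : rval ∈ R K }.
Implicit Types (q r : real).

Lemma rval_inj : injective rval.
Proof. by move=> [x xR] [y yR] /= E; subst y; congr Real; exact: Prop_irrelevance. Qed.

HB.instance Definition _ := gen_eqMixin real.
HB.instance Definition _ := gen_choiceMixin real.

(** Totality, with default [zero K], turns a quantifier over [real] into a quantifier over V bounded
    by [R K]. *)
Definition to_real x : real :=
  match pselect (x ∈ R K) with left H => Real H | right _ => Real (zero_in hK) end.

Lemma to_realK x : x ∈ R K -> rval (to_real x) = x.
Proof. by rewrite /to_real; case: pselect. Qed.

Lemma rvalK : cancel rval to_real.
Proof. by move=> r; apply: rval_inj; apply: to_realK; exact: rvalP. Qed.

Lemma definable_to_real t :
  definable_term t -> definable_term (fun e => rval (to_real (t e))).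
Proof.
move=> dt; rewrite /definable_term.
apply: (@definable_ext _ (fun e => (t (shift e) ∈ R K /\ e 0 = t (shift e)) \/
  (~ t (shift e) ∈ R K /\ e 0 = zero K))).
  move=> e; rewrite /to_real; case: pselect => H /=.
    by split=> [[[]|[]]|]; auto.
  by split=> [[[]|[]]|]; auto.
by have dt1 := definable_term_shift dt; definability.
Qed.
Hint Extern 1 (definable_term (fun e => rval (to_real (@?t e)))) =>
  apply: (@definable_to_real t); cbv beta : definable.

Lemma definable_eq_real (s t : (nat -> V) -> real) :
  definable_term (fun e => rval (s e)) -> definable_term (fun e => rval (t e)) ->
  definable (fun e => s e = t e).
Proof.
move=> ds dt; apply: definable_ext (definable_eq ds dt) => e.
by split=> [/rval_inj|->].
Qed.
Hint Extern 1 (definable (fun e => @eq _ (@?s e) (@?t e))) =>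
  apply: (@definable_eq_real s t); cbv beta : definable.

Lemma definable_forall_real (Q : (nat -> V) -> real -> Prop) :
  definable (fun e => Q (shift e) (to_real (e 0))) ->
  definable (fun e => forall r, Q e r).
Proof.
move=> dQ; apply: (@definable_ext _ (fun e => forall x, x ∈ R K -> Q e (to_real x))).
  by move=> e; split=> H r; [rewrite -(rvalK r); apply: H; exact: rvalP|].
by apply: definable_forall; definability.
Qed.
Hint Extern 1 (definable (fun e => forall r : real, @?Q e r)) =>
  apply: (@definable_forall_real Q); cbv beta : definable.

Lemma definable_exists_real (Q : (nat -> V) -> real -> Prop) :
  definable (fun e => Q (shift e) (to_real (e 0))) ->
  definable (fun e => exists r, Q e r).
Proof.
move=> dQ; apply: (@definable_ext _ (fun e => exists x, x ∈ R K /\ Q e (to_real x))).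
  move=> e; split=> [[x [xR Qx]]|[r Qr]]; first by exists (to_real x).
  by exists (rval r); rewrite rvalK; split=> //; exact: rvalP.
by apply: definable_exists; definability.
Qed.
Hint Extern 1 (definable (fun e => exists r : real, @?Q e r)) =>
  apply: (@definable_exists_real Q); cbv beta : definable.

Definition the_real (P : real -> Prop) : real :=
  to_real (the (fun x => x ∈ R K /\ P (to_real x))).

Lemma the_realP (P : real -> Prop) : (exists! r, P r) -> P (the_real P).
Proof.
move=> [r [Pr ur]].
have : exists! x, x ∈ R K /\ P (to_real x).
  exists (rval r); split=> [|x [xR /ur ->]]; rewrite ?rvalK ?to_realK //.
  by split=> //; exact: rvalP.
by move/theP => [].
Qed.

Lemma the_real_eq (P : real -> Prop) r : P r -> (forall q, P q -> q = r) ->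
  the_real P = r.
Proof.
by move=> Pr ur; apply: (ur); apply: the_realP; exists r; split=> // q /ur ->.
Qed.

Lemma definable_the_real (P : (nat -> V) -> real -> Prop) :
  definable (fun e => P (shift e) (to_real (e 0))) ->
  definable_term (fun e => rval (the_real (P e))).
Proof.
move=> dP; rewrite /the_real; apply: definable_to_real; apply: definable_the.
definability.
Qed.
Hint Extern 1 (definable_term (fun e => rval (the_real (@?P e)))) =>
  apply: (@definable_the_real P); cbv beta : definable.

Definition fun2_val f x y : real :=
  the_real (fun r => pair (pair x y) (rval r) ∈ f).

Lemma definable_fun2_val (u s t : (nat -> V) -> V) : definable_term u ->
  definable_term s -> definable_term t ->
  definable_term (fun e => rval (fun2_val (u e) (s e) (t e))).
Proof.
move=> du ds dt; apply: definable_the_real.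
have du1 := definable_term_shift du.
have ds1 := definable_term_shift ds.
have dt1 := definable_term_shift dt.
definability.
Qed.
Hint Extern 1 (definable_term (fun e => rval (fun2_val (@?f e) (@?s e) (@?t e)))) =>
  apply: (@definable_fun2_val f s t); cbv beta : definable.

Lemma fun2_valP f a b x y z : is_fun2 f a b (R K) -> x ∈ a -> y ∈ b ->
  rel2 f x y z <-> z = rval (fun2_val f x y).
Proof.
move=> /is_fun2E [fd [ff _]] xa yb.
have [w [xyw uw]] := ff _ _ xa yb.
have [_ [_ wR]] := fd _ _ _ xyw.
have -> : rval (fun2_val f x y) = w.
  rewrite -(to_realK wR); congr rval; apply: the_real_eq.
    by rewrite to_realK // -rel2E.
  by move=> q /rel2E /uw ->; rewrite rvalK.
by split=> [/uw|->].
Qed.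

Definition real0 : real := Real (zero_in hK).
Definition real1 : real := Real (one_in hK).
Definition real_add q r : real := fun2_val (add K) (rval q) (rval r).
Definition real_mul q r : real := fun2_val (mul K) (rval q) (rval r).
(** Opposite and inverse are descriptions inside the model rather than choices in the ambient logic,
    which is what makes them definable. The inverse of 0 is fixed as 0, following the convention of
    the field structure. *)
Definition real_opp r : real := the_real (fun q => real_add q r = real0).
Definition real_inv r : real :=
  the_real (fun q => (r = real0 /\ q = real0) \/ (r <> real0 /\ real_mul q r = real1)).
Definition real_le q r : bool := `[< pair (rval q) (rval r) ∈ leq K >].
Definition real_lt q r : bool := (r != q) && real_le q r.
Definition real_norm r : real :=
  the_real (fun q => (real_le real0 r /\ q = r) \/ (~ real_le real0 r /\ q = real_opp r)).

Lemma rel2_addE q r x : rel2 (add K) (rval q) (rval r) x <-> x = rval (real_add q r).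
Proof. exact: fun2_valP (add_fun hK) (rvalP q) (rvalP r). Qed.

Lemma rel2_mulE q r x : rel2 (mul K) (rval q) (rval r) x <-> x = rval (real_mul q r).
Proof. exact: fun2_valP (mul_fun hK) (rvalP q) (rvalP r). Qed.

Lemma real_leE q r : real_le q r <-> le K (rval q) (rval r).
Proof. by rewrite /le relE; split=> /asboolP. Qed.

Fact real_addC : commutative real_add.
Proof.
by move=> q r; apply/rval_inj/rel2_addE; apply: (add_comm hK); by rewrite rel2_addE.
Qed.

Fact real_addA : associative real_add.
Proof.
move=> x y z; apply/esym/rval_inj/rel2_addE.
apply: (add_assoc hK (x := rval x) (y := rval y) (z := rval z) (u := rval (real_add x y)));
  by rewrite rel2_addE.
Qed.

Fact real_add0 : left_id real0 real_add.
Proof.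
move=> x; apply/esym/rval_inj/rel2_addE; apply: (add_comm hK).
by apply: (add_zero hK); exact: rvalP.
Qed.

Fact real_addN : left_inverse real0 real_opp real_add.
Proof.
move=> x; apply: (@the_realP (fun q => real_add q x = real0)).
have [y xy0] := add_opp hK (rvalP x).
have [_ [yR _]] := ((is_fun2E _ _ _ _).1 (add_fun hK)).1 _ _ _ xy0.
rewrite -(to_realK yR) in xy0; move: xy0 => /rel2_addE xy0.
have {}xy0 : real_add (to_real y) x = real0 by rewrite real_addC; apply: rval_inj.
exists (to_real y); split=> // z zx0.
by rewrite -[LHS]real_add0 -zx0 -real_addA (real_addC x) xy0 real_addC real_add0.
Qed.

HB.instance Definition _ :=
  GRing.isZmodule.Build real real_addA real_addC real_add0 real_addN.

Fact real_mulC : commutative real_mul.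
Proof. by move=> q r; apply/rval_inj/rel2_mulE; apply: (mul_comm hK); by rewrite rel2_mulE. Qed.

Fact real_mulA : associative real_mul.
Proof.
move=> x y z; apply/esym/rval_inj/rel2_mulE.
apply: (mul_assoc hK (x := rval x) (y := rval y) (z := rval z) (u := rval (real_mul x y)));
  by rewrite rel2_mulE.
Qed.

Fact real_mul1 : left_id real1 real_mul.
Proof.
move=> x; apply/esym/rval_inj/rel2_mulE; apply: (mul_comm hK).
by apply: (mul_one hK); exact: rvalP.
Qed.

Fact real_mulD : left_distributive real_mul real_add.
Proof.
move=> x y z; rewrite !(real_mulC _ z); apply/rval_inj/rel2_addE.
apply: (mul_add hK (x := rval z) (y := rval x) (z := rval y) (s := rval (real_add x y)));
  by rewrite ?rel2_addE ?rel2_mulE.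
Qed.

Fact real1_neq0 : real1 != real0.
Proof. by apply/eqP => /(congr1 rval) /=; exact: one_neq_zero. Qed.

HB.instance Definition _ := GRing.Zmodule_isComNzRing.Build real
  real_mulA real_mulC real_mul1 real_mulD real1_neq0.

Fact real_mulV r : r != real0 -> real_mul (real_inv r) r = real1.
Proof.
move: r => x /eqP x0.
suff : (x = real0 /\ real_inv x = real0) \/ (x <> real0 /\ real_mul (real_inv x) x = real1).
  by case=> -[].
apply: (@the_realP (fun q =>
  (x = real0 /\ q = real0) \/ (x <> real0 /\ real_mul q x = real1))).
have [|y xy1] := Defs.mul_inv hK (rvalP x).
  by move=> H; apply: x0; apply: rval_inj.
have [_ [yR _]] := ((is_fun2E _ _ _ _).1 (mul_fun hK)).1 _ _ _ xy1.
rewrite -(to_realK yR) in xy1; move: xy1 => /rel2_mulE xy1.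
have {}xy1 : real_mul (to_real y) x = real1 by rewrite real_mulC; apply: rval_inj.
exists (to_real y); split=> [|z [[] //|[_ zx1]]]; first by right.
by rewrite -[LHS]real_mul1 -zx1 -real_mulA (real_mulC x) xy1 real_mulC real_mul1.
Qed.

Fact real_inv0 : real_inv real0 = real0.
Proof. by apply: the_real_eq => [|q [[]|[/(_ erefl)]]] //; left. Qed.

HB.instance Definition _ := GRing.ComNzRing_isField.Build real real_mulV real_inv0.

Local Open Scope ring_scope.

Fact real_addE q r : real_add q r = q + r.
Proof. by []. Qed.

Fact real_le_add q r (z : real) : real_le q r -> real_le (real_add q z) (real_add r z).
Proof.
rewrite !real_leE => qr.
by apply: (le_add hK (x := rval q) (y := rval r) (z := rval z)); rewrite ?rel2_addE.
Qed.

Fact real_sub_ge0 q r : real_le 0 (r - q) = real_le q r.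
Proof.
apply/idP/idP => [/(real_le_add q)|/(real_le_add (- q))].
  by rewrite !real_addE subrK add0r.
by rewrite !real_addE subrr.
Qed.

Fact real_le0_add q r : real_le 0 q -> real_le 0 r -> real_le 0 (q + r).
Proof.
move=> /(real_le_add r) + /real_leE r0; rewrite real_addE add0r => /real_leE rq.
by apply/real_leE; apply: (Defs.le_trans hK) r0 rq.
Qed.

Fact real_le0_mul q r : real_le 0 q -> real_le 0 r -> real_le 0 (q * r).
Proof.
rewrite !real_leE => q0 r0.
by apply: (le_mul hK q0 r0); rewrite rel2_mulE.
Qed.

Fact real_le0_anti r : real_le 0 r -> real_le r 0 -> r = 0.
Proof.
by rewrite !real_leE => r0 r0'; apply/rval_inj/(Defs.le_antisym hK).
Qed.

Fact real_le0_total r : real_le 0 r || real_le r 0.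
Proof.
by apply/orP; have := Defs.le_total hK (rvalP 0) (rvalP r); rewrite -!real_leE.
Qed.

Fact real_ge0_norm r : real_le 0 r -> real_norm r = r.
Proof. by move=> r0; apply: the_real_eq; [left|move=> q [[]|[/(_ r0)]]]. Qed.

Fact real_normN r : real_norm (- r) = real_norm r.
Proof.
have E (q : real) : ~ real_le 0 q -> real_norm q = - q.
  by move=> nq; apply: the_real_eq; [right|move=> z [[/nq]|[]]].
have N0 (q : real) : real_le 0 (- q) = real_le q 0 by rewrite -[RHS]real_sub_ge0 sub0r.
case: (boolP (real_le 0 r)) => [r0|/negP r0].
  case: (boolP (real_le 0 (- r))) => [r0'|/negP r0'].
    have -> : r = 0 by apply: real_le0_anti; rewrite -?N0.
    by rewrite oppr0.
  by rewrite E // opprK real_ge0_norm.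
rewrite (E r) // real_ge0_norm // N0.
by have := real_le0_total r; case/orP.
Qed.

Fact real_lt_def q r : real_lt q r = (r != q) && real_le q r.
Proof. by []. Qed.

HB.instance Definition _ := Num.IntegralDomain_isLeReal.Build real
  real_le0_add real_le0_mul real_le0_anti real_sub_ge0 real_le0_total
  real_normN real_ge0_norm real_lt_def.

Lemma leE q r : (q <= r) <-> le K (rval q) (rval r).
Proof. exact: real_leE. Qed.

Lemma ltE q r : (q < r) <-> lt K (rval q) (rval r).
Proof.
rewrite /lt -leE lt_neqAle; split=> [/andP[/eqP qr ->]|[-> qr]].
  by split=> // /rval_inj.
by rewrite andbT; apply/eqP => E; apply: qr; rewrite E.
Qed.

(** * Definability of arithmetic and order *)

Section DefinableReals.
Variables s t : (nat -> V) -> real.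
Hypotheses (ds : definable_term (fun e => rval (s e)))
  (dt : definable_term (fun e => rval (t e))).

Lemma definable_real_add : definable_term (fun e => rval (s e + t e)).
Proof.
apply: (@definable_fun2_val _ (fun e => rval (s e)) (fun e => rval (t e))) => //.
exact: definable_term_const.
Qed.

Lemma definable_real_mul : definable_term (fun e => rval (s e * t e)).
Proof.
apply: (@definable_fun2_val _ (fun e => rval (s e)) (fun e => rval (t e))) => //.
exact: definable_term_const.
Qed.

Lemma definable_real_le : definable (fun e => s e <= t e).
Proof.
apply: (@definable_ext _ (fun e => pair (rval (s e)) (rval (t e)) ∈ leq K)).
  by move=> e; rewrite -relE leE.
definability.
Qed.

End DefinableReals.

Hint Extern 1 (definable_term (fun e => rval (@GRing.add _ (@?s e) (@?t e)))) =>
  apply: (@definable_real_add s t); cbv beta : definable.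
Hint Extern 1 (definable_term (fun e => rval (@GRing.mul _ (@?s e) (@?t e)))) =>
  apply: (@definable_real_mul s t); cbv beta : definable.
Hint Extern 1 (definable (fun e => is_true (@Order.le _ _ (@?s e) (@?t e)))) =>
  apply: (@definable_real_le s t); cbv beta : definable.

Section DefinableReals2.
Variables s t : (nat -> V) -> real.
Hypotheses (ds : definable_term (fun e => rval (s e)))
  (dt : definable_term (fun e => rval (t e))).

Lemma definable_real_lt : definable (fun e => s e < t e).
Proof.
apply: (@definable_ext _ (fun e => s e <= t e /\ ~ s e = t e)).
  move=> e; rewrite lt_neqAle; split=> [[-> /eqP ->]|/andP[/eqP ? ->]] //.
definability.
Qed.

Lemma definable_real_opp : definable_term (fun e => rval (- s e)).
Proof.
have ds1 := definable_term_shift ds; apply: definable_the_real.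
apply: (@definable_eq_real (fun e => to_real (e O) + s (shift e)) (fun=> 0));
  definability.
Qed.

Lemma definable_real_inv : definable_term (fun e => rval (s e)^-1).
Proof.
have ds1 := definable_term_shift ds; apply: definable_the_real.
apply: (@definable_ext _ (fun e => (s (shift e) = 0 /\ to_real (e O) = 0) \/
  (s (shift e) <> 0 /\ to_real (e O) * s (shift e) = 1))) => //.
definability.
Qed.

Lemma definable_real_min : definable_term (fun e => rval (Order.min (s e) (t e))).
Proof.
have ds1 := definable_term_shift ds; have dt1 := definable_term_shift dt.
apply: (@definable_ext _ (fun e =>
  (s (shift e) <= t (shift e) /\ e O = rval (s (shift e))) \/
  (~ s (shift e) <= t (shift e) /\ e O = rval (t (shift e))))).
  move=> e; case: leP => _; split; try by [case=> -[] | left | right].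
definability.
Qed.

End DefinableReals2.

Hint Extern 1 (definable_term (fun e => rval (@GRing.opp _ (@?s e)))) =>
  apply: (@definable_real_opp s); cbv beta : definable.
Hint Extern 1 (definable_term (fun e => rval (@GRing.inv _ (@?s e)))) =>
  apply: (@definable_real_inv s); cbv beta : definable.
Hint Extern 1 (definable (fun e => is_true (@Order.lt _ _ (@?s e) (@?t e)))) =>
  apply: (@definable_real_lt s t); cbv beta : definable.
Hint Extern 1 (definable_term (fun e => rval (@Order.min _ _ (@?s e) (@?t e)))) =>
  apply: (@definable_real_min s t); cbv beta : definable.

Lemma definable_real_norm (s : (nat -> V) -> real) :
  definable_term (fun e => rval (s e)) -> definable_term (fun e => rval `|s e|).
Proof.
move=> ds; have ds1 := definable_term_shift ds.
apply: (@definable_ext _ (fun e =>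
  (0 <= s (shift e) /\ e O = rval (s (shift e))) \/
  (~ 0 <= s (shift e) /\ e O = rval (- s (shift e))))).
  by move=> e; case: ger0P => H; split; try by [case=> -[] | left | right].
definability.
Qed.
#[local] Opaque real_add real_mul real_opp real_inv real_le real_lt real_norm.
Hint Extern 1 (definable_term (fun e => rval (@Num.norm _ _ (@?s e)))) =>
  apply: (@definable_real_norm s); cbv beta : definable.

(** * Suprema and infima of definable sets of reals *)

Definition is_real_sup (P : real -> Prop) r : Prop :=
  (forall q, P q -> q <= r) /\ forall b : real, (forall q, P q -> q <= b) -> r <= b.

Definition real_sup (P : real -> Prop) : real := the_real (is_real_sup P).

(** Completeness of [K] concerns sets of the model only, so [P] has to be definable in order to be
    separated from [R K]. *)
Lemma real_supP (P : real -> Prop) : definable (fun e => P (to_real (e O))) ->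
  (exists r, P r) -> (exists b : real, forall r, P r -> r <= b) ->
  is_real_sup P (real_sup P).
Proof.
move=> dP [r0 Pr0] [b0 Hb0]; apply: the_realP.
have inS x : x ∈ sep (R K) (fun x => P (to_real x)) <-> x ∈ R K /\ P (to_real x).
  by rewrite mem_sep.
have := complete hK (s := sep (R K) (fun x => P (to_real x))).
case=> [x /inS[]//|||s [[sR sub] sl]].
- by exists (rval r0); apply/inS; rewrite rvalK; split=> //; exact: rvalP.
- exists (rval b0); split=> [|x /inS[xR /Hb0]]; first exact: rvalP.
  by rewrite leE to_realK.
exists (to_real s); split.
  split=> [q Pq|b Hb].
    rewrite leE to_realK //; apply: sub; apply/inS.
    by rewrite rvalK; split=> //; exact: rvalP.
  rewrite leE to_realK //; apply: sl; split=> [|x /inS[xR /Hb]]; first exact: rvalP.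
  by rewrite leE to_realK.
move=> q [qub ql]; apply/le_anti/andP; split; last first.
  apply: ql => r Pr; rewrite leE to_realK //; apply: sub; apply/inS.
  by rewrite rvalK; split=> //; exact: rvalP.
rewrite leE to_realK //; apply: sl; split=> [|x /inS[xR /qub]]; first exact: rvalP.
by rewrite leE to_realK.
Qed.

Lemma definable_real_sup (P : (nat -> V) -> real -> Prop) :
  definable (fun e => P (shift e) (to_real (e O))) ->
  definable_term (fun e => rval (real_sup (P e))).
Proof.
move=> dP; rewrite /real_sup; apply: definable_the_real; rewrite /is_real_sup.
have dP1 := @definable_weaken _ (fun e x => P e (to_real x)) dP.
have dP2 := @definable_weaken _ (fun e x => P (shift e) (to_real x)) dP1.
by apply: definable_and; definability.
Qed.
Hint Extern 1 (definable_term (fun e => rval (real_sup (@?P e)))) =>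
  apply: (@definable_real_sup P); cbv beta : definable.

Definition real_inf (P : real -> Prop) : real :=
  real_sup (fun l => forall r, P r -> l <= r).

(** The set of lower bounds is nonempty by the given bound and is bounded above by any element of
    [P], so it has a supremum. *)
Lemma real_infP (P : real -> Prop) : definable (fun e => P (to_real (e O))) ->
  (exists r, P r) -> (exists b : real, forall r, P r -> b <= r) ->
  (forall r, P r -> real_inf P <= r) /\
  (forall b : real, (forall r, P r -> b <= r) -> b <= real_inf P).
Proof.
move=> dP [r0 Pr0] [b0 Hb0].
have [||| H1 H2] := @real_supP (fun l => forall r, P r -> l <= r).
- have dP1 : definable (fun e : nat -> V => P (to_real (e O))) by [].
  have := @definable_weaken _ (fun _ x => P (to_real x)) dP1.
  by move=> dP2; definability.
- by exists b0.
- by exists r0 => l; apply.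
split=> // r Pr; apply: H2 => q; exact.
Qed.

Lemma definable_real_inf (P : (nat -> V) -> real -> Prop) :
  definable (fun e => P (shift e) (to_real (e O))) ->
  definable_term (fun e => rval (real_inf (P e))).
Proof.
move=> dP; rewrite /real_inf; apply: definable_real_sup.
have dP1 := @definable_weaken _ (fun e x => P e (to_real x)) dP.
by definability.
Qed.
Hint Extern 1 (definable_term (fun e => rval (real_inf (@?P e)))) =>
  apply: (@definable_real_inf P); cbv beta : definable.

#[local] Opaque fun2_val the_real real_sup real_inf.

(** * The embedding of omega into the reals *)

(** Recursion without finite approximations: the graph is the intersection of all sets that contain
    the initial pair and are closed under the recursion step. *)
Definition nat_graph n x : Prop :=
  forall H : V, pair void (rval 0) ∈ H ->
    (forall m r, m ∈ omega -> pair m (rval r) ∈ H ->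
       pair (succ m) (rval (r + 1)) ∈ H) ->
    pair n x ∈ H.

Definition natr n : real :=
  the_real (fun r => nat_graph n (rval r)).

Lemma definable_natr t : definable_term t -> definable_term (fun e => rval (natr (t e))).
Proof.
move=> dt; rewrite /natr /nat_graph; apply: definable_the_real.
have dt2 := definable_term_shift (definable_term_shift dt).
definability.
Qed.
Hint Extern 1 (definable_term (fun e => rval (natr (@?t e)))) =>
  apply: (@definable_natr t); cbv beta : definable.

(** The pairs of the graph that have one of the two stated forms make up a set closed under the
    recursion, so this set contains the least such graph. *)
Lemma nat_graph_inv n r : nat_graph n (rval r) -> (n = void /\ r = 0) \/
  exists m q, m ∈ omega /\ nat_graph m (rval q) /\ n = succ m /\ r = q + 1.
Proof.
pose P n r := (n = void /\ r = 0) \/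
  exists m (q : real), m ∈ omega /\ nat_graph m (rval q) /\ n = succ m /\ r = q + 1.
pose S := sep (cprod omega (R K)) (fun p =>
  exists n r, p = pair n (rval r) /\ nat_graph n (rval r) /\ P n r).
have inS m q : pair m (rval q) ∈ S <-> m ∈ omega /\ nat_graph m (rval q) /\ P m q.
  rewrite /S mem_sep; last by rewrite /P /nat_graph; definability.
  rewrite pair_in_cprod; split=> [[[mw _] [k [z [/pair_inj [<- /rval_inj <-] H]]]]|[mw H]] //.
  split; first by split=> //; exact: rvalP.
  by exists m, q.
suff H : nat_graph n (rval r) -> pair n (rval r) ∈ S by move=> /H /inS [_ []].
apply; first by apply/inS; split; [exact: void_omega|split=> //; left].
move=> m q mw /inS [_ [gm Pm]]; apply/inS; split; first exact: succ_omega.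
split; last by right; exists m, q.
by move=> H H0 HS; apply: (HS) => //; apply: gm.
Qed.

Lemma nat_graph_total n : n ∈ omega -> exists! r : real, nat_graph n (rval r).
Proof.
move: n; apply: omega_ind; first by rewrite /nat_graph /unique; definability.
  exists 0; split=> [H //|r /nat_graph_inv [[_ ->]//|[m [q [_ [_ [/esym/succ_neq_void]]]]]] //].
move=> n nw [r [gr ur]]; exists (r + 1); split.
  by move=> H H0 HS; apply: (HS) => //; apply: gr.
move=> q /nat_graph_inv [[/succ_neq_void]//|[m [z [_ [gz [/succ_inj E ->]]]]]].
by rewrite (ur z) // E.
Qed.

Lemma natr_graph n : n ∈ omega -> nat_graph n (rval (natr n)).
Proof. by move/nat_graph_total/the_realP. Qed.

Lemma natr_void : natr void = 0.
Proof.
case/nat_graph_inv: (natr_graph void_omega) => [[]//|].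
by move=> [m [q [_ [_ [/esym/succ_neq_void]]]]].
Qed.

Lemma natr_succ n : n ∈ omega -> natr (succ n) = natr n + 1.
Proof.
move=> nw; case/nat_graph_inv: (natr_graph (succ_omega nw)) => [[/succ_neq_void]//|].
move=> [m [q [_ [gq [/succ_inj E ->]]]]]; congr (_ + 1); subst m.
have [r [_ ur]] := nat_graph_total nw.
by rewrite -(ur q) // -(ur (natr n)) //; exact: natr_graph.
Qed.

Lemma natr_mem_lt n m : n ∈ omega -> m ∈ n -> natr m < natr n.
Proof.
move=> nw; move: n nw m; apply: omega_ind; first by definability.
  by move=> m /in_void.
move=> n nw IH m /in_succ; rewrite natr_succ // => -[/IH|->]; lra.
Qed.

Lemma natr_lt_mem m n : m ∈ omega -> n ∈ omega -> natr m < natr n -> m ∈ n.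
Proof.
move=> mw nw lt_mn; case: (omega_total mw nw) => [//|[E|/(natr_mem_lt mw)]].
  by move: lt_mn; rewrite E ltxx.
by move=> /(lt_trans lt_mn); rewrite ltxx.
Qed.

Lemma natr_ge0 n : n ∈ omega -> 0 <= natr n.
Proof.
move: n; apply: omega_ind; first by definability.
  by rewrite natr_void.
by move=> n nw; rewrite natr_succ //; lra.
Qed.

(** If the values were bounded, their supremum [s] could be lowered to [s - 1], because the
    successor of each index also has its value below [s]. *)
Lemma natr_archi r : exists n, n ∈ omega /\ r < natr n.
Proof.
apply: contrapT => H.
have [|||ub least] := @real_supP (fun q => exists n, n ∈ omega /\ q = natr n).
- by definability.
- by exists 0, void; rewrite natr_void; split=> //; exact: void_omega.
- exists r => q [n [nw ->]]; rewrite leNgt; apply/negP => rn.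
  by apply: H; exists n.
set s := real_sup _ in ub least.
suff : s <= s - 1 by lra.
apply: least => q [n [nw ->]].
have : natr (succ n) <= s.
  by apply: ub; exists (succ n); split=> //; exact: succ_omega.
rewrite natr_succ //; lra.
Qed.

#[local] Opaque natr.

(** * Metrics *)

Record is_metric X (D : V -> V -> real) : Prop := {
  is_metric_ge0 : forall x y, x ∈ X -> y ∈ X -> 0 <= D x y;
  is_metric_eq0 : forall x y, x ∈ X -> y ∈ X -> D x y = 0 <-> x = y;
  is_metric_sym : forall x y, x ∈ X -> y ∈ X -> D x y = D y x;
  is_metric_triangle : forall x y z, x ∈ X -> y ∈ X -> z ∈ X ->
    D x z <= D x y + D y z
}.

Definition metric_open X (D : V -> V -> real) U : Prop :=
  U ⊆ X /\ forall x, x ∈ U ->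
    exists r, 0 < r /\ forall y, y ∈ X -> D x y < r -> y ∈ U.

Definition bounded (D : V -> V -> real) A : Prop :=
  exists r, forall x y, x ∈ A -> y ∈ A -> D x y <= r.

Section MetricSet.
Variables (X d : V) (dM : metric K X d).

Lemma metric_valP x y z : x ∈ X -> y ∈ X ->
  rel2 d x y z <-> z = rval (fun2_val d x y).
Proof. exact: fun2_valP (metric_fun dM). Qed.

Lemma metric_val x y : x ∈ X -> y ∈ X -> rel2 d x y (rval (fun2_val d x y)).
Proof. by move=> xX yX; apply/metric_valP. Qed.

Lemma metric_is_metric : is_metric X (fun2_val d).
Proof.
split=> [x y xX yX|x y xX yX|x y xX yX|x y z xX yX zX].
- by rewrite leE; apply: (metric_ge0 dM (metric_val xX yX)).
- rewrite -(metric_eq0 dM) // metric_valP //; split=> [->//|E].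
  exact/esym/rval_inj.
- by apply: rval_inj; apply/metric_valP=> //; apply/(metric_sym dM)/metric_val.
- rewrite leE; apply: (metric_triangle dM (x := x) (y := y) (z := z)
    (metric_val xX yX) (metric_val yX zX) (metric_val xX zX)).
  exact/rel2_addE.
Qed.

Lemma induces_topologyE T : induces_topology K X d T <->
  forall U, U ∈ T <-> metric_open X (fun2_val d) U.
Proof.
suff E U : (U ⊆ X /\ (forall x, x ∈ U -> exists u b, u ∈ R K /\ lt K (zero K) u /\
       is_ball K X d b x u /\ b ⊆ U)) <-> metric_open X (fun2_val d) U.
  by split=> H U; have := H U; rewrite E.
have in_ball x r b : x ∈ X -> is_ball K X d b x (rval r) -> forall y,
    y ∈ b <-> y ∈ X /\ fun2_val d x y < r.
  move=> xX Hb y; rewrite Hb; split=> -[yX]; last first.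
    move=> /ltE xyr; split=> //; exists (rval (fun2_val d x y)).
    by split=> //; exact: metric_val.
  by move=> [s [/(metric_valP _ xX yX) -> /ltE]].
split=> -[UX H]; split=> // x xU; have xX := UX _ xU.
  have [r [b [rR [r0 [Hb bU]]]]] := H x xU.
  exists (to_real r); split; first by apply/ltE; rewrite to_realK.
  move=> y yX xyr; apply: bU; rewrite -(to_realK rR) in Hb.
  exact/(in_ball _ _ _ xX Hb).
have [r [r0 Hr]] := H x xU.
have db : definable (fun e => fun2_val d x (e O) < r) by definability.
exists (rval r), (sep X (fun y => fun2_val d x y < r)).
split; first exact: rvalP.
split; first exact: ((ltE 0 r).1 r0).
split; last by move=> y; rewrite mem_sep // => -[yX]; exact: Hr.
move=> y; rewrite mem_sep //; split=> -[yX]; last first.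
  by move=> [s [/(metric_valP _ xX yX) -> /ltE]].
move=> /ltE xyr; split=> //; exists (rval (fun2_val d x y)).
by split=> //; exact: metric_val.
Qed.

Lemma finite_diamE A : A ⊆ X -> finite_diam K d A <-> bounded (fun2_val d) A.
Proof.
move=> AX; split=> [[r [[rR [r0 Hr]] _]]|[r Hr]].
  exists (to_real r) => x y xA yA; rewrite leE to_realK //.
  by apply: Hr xA yA (metric_val (AX _ xA) (AX _ yA)).
(* Adjoining 0 keeps the set nonempty when [A] is empty and makes the supremum nonnegative, in
   accordance with a supremum taken in [0, +∞]. *)
have [|||ub least] := @real_supP (fun q => q = 0 \/
    exists x y, x ∈ A /\ y ∈ A /\ q = fun2_val d x y).
- definability.
- by exists 0; left.
- exists (`|r|) => q [->|[x [y [xA [yA ->]]]]]; first exact: normr_ge0.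
  by apply: (le_trans (Hr _ _ xA yA)); exact: ler_norm.
set s := real_sup _ in ub least.
exists (rval s); split.
  split; first exact: rvalP.
  split; first by apply: ((leE 0 s).1 _); apply: ub; left.
  move=> x y z xA yA /(metric_valP _ (AX _ xA) (AX _ yA)) ->; apply/leE.
  by apply: ub; right; exists x, y.
move=> z [zR [z0 Hz]]; rewrite -(to_realK zR); apply/leE; apply: least => q.
move=> [->|[x [y [xA [yA ->]]]]]; rewrite leE to_realK //.
by apply: Hz xA yA (metric_val (AX _ xA) (AX _ yA)).
Qed.

End MetricSet.

(** The passage from a function of the ambient logic to a metric of the model: definability of [D]
    allows its graph to be separated from the product. *)
Lemma metric_exists X (D : V -> V -> real) :
  definable_fun2 (fun x y => rval (D x y)) -> is_metric X D ->
  exists d, metric K X d /\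
    forall x y, x ∈ X -> y ∈ X -> fun2_val d x y = D x y.
Proof.
move=> dD [D0 Deq Dsym Dtri].
pose d := sep (cprod (cprod X X) (R K))
  (fun p => exists x y, p = pair (pair x y) (rval (D x y))).
have rel_d x y z : rel2 d x y z <-> x ∈ X /\ y ∈ X /\ z = rval (D x y).
  rewrite rel2E /d mem_sep; last by definability.
  rewrite !pair_in_cprod; split.
    by move=> [[[xX yX] _] [x' [y' /pair_inj [/pair_inj [<- <-] ->]]]].
  move=> [xX [yX ->]]; split; last by exists x, y.
  by split=> //; exact: rvalP.
have df : is_fun2 d X X (R K).
  apply/is_fun2E; split.
    by move=> x y z /rel_d [xX [yX ->]]; split=> //; split=> //; exact: rvalP.
  split; last by move=> p; rewrite /d mem_sep; [case|definability].
  move=> x y xX yX; exists (rval (D x y)); split; first exact/rel_d.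
  by move=> z /rel_d [_ [_ ->]].
exists d; split; last first.
  move=> x y xX yX; apply: rval_inj.
  have /(fun2_valP _ df xX yX) : rel2 d x y (rval (D x y)) by apply/rel_d.
  by move=> ->.
split=> //.
- by move=> x y r /rel_d [xX [yX ->]]; apply: ((leE 0 _).1 _); exact: D0.
- move=> x y xX yX; rewrite rel_d -(Deq x y) //; split=> [[_ [_ E]]|E].
    by apply: rval_inj; rewrite -E.
  by rewrite E.
- by move=> x y r; rewrite !rel_d => -[xX [yX ->]]; rewrite Dsym.
- move=> x y z r s t u; rewrite !rel_d => -[xX [yX ->]] [_ [zX ->]] [_ [_ ->]].
  by rewrite rel2_addE => ->; apply/leE; exact: Dtri.
Qed.

(** * Metrizable universes are proper and countably based *)

(** No choice is involved: each element is sent to its least index. The set [s] consists of the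
    indices at which [F] takes a new value. *)
Lemma countable_image (F : V -> V) a : definable_fun F ->
  (forall x, x ∈ a <-> exists n, n ∈ omega /\ x = F n) -> countable a.
Proof.
move=> dF Ha.
pose s := sep omega (fun n => forall m, m ∈ n -> F m <> F n).
have ins n : n ∈ s <-> n ∈ omega /\ forall m, m ∈ n -> F m <> F n.
  by rewrite mem_sep //; definability.
have df : definable (fun e => exists n, e O = pair (F n) n) by definability.
pose f := sep (cprod a s) (fun p => exists n, p = pair (F n) n).
have inf x n : pair x n ∈ f <-> n ∈ s /\ x = F n.
  rewrite mem_sep // pair_in_cprod; split=> [[[_ ns] [m /pair_inj [-> nm]]]|[ns ->]].
    by subst m.
  split; last by exists n.
  split=> //; rewrite Ha; exists n; split=> //.
  by have /ins [] := ns.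
exists omega, s, f; split; first exact: is_omega_omega.
split; first by move=> n /ins [].
split; last first.
  move=> n ns; exists (F n); split=> [|x]; first by rewrite relE inf.
  by rewrite relE inf => -[_ ->].
apply/is_funE; split; first by move=> p; rewrite mem_sep // => -[].
move=> x /Ha [n [nw xF]].
have [||m [mw [xFm least]]] := @omega_least (fun n => x = F n).
- definability.
- by exists n.
have ms : m ∈ s by apply/ins; split=> // k /least + kF; apply; rewrite xFm.
exists m; split; first exact/inf.
move=> k /inf [/ins [kw Hk] xFk].
case: (omega_total mw kw) => [/Hk|[//|/least]] //.
by rewrite -xFm -xFk.
Qed.

Section Closure.
Variables (X T : V) (D : V -> V -> real).
Hypotheses (dD : definable_fun2 (fun x y => rval (D x y)))
  (DM : is_metric X D) (DT : forall U, U ∈ T <-> metric_open X D U).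

Lemma metric_openI (P : V -> Prop) : definable (fun e => P (e O)) ->
  (forall x, x ∈ X -> P x ->
    exists r, 0 < r /\ forall y, y ∈ X -> D x y < r -> P y) ->
  sep X P ∈ T.
Proof.
move=> dP H; apply/DT; split=> [x|x]; rewrite mem_sep // => -[] // xX Px.
have [r [r0 Hr]] := H x xX Px; exists r; split=> // y yX xyr.
by rewrite mem_sep //; split=> //; apply: Hr.
Qed.

(** A ball around [x] that misses [A] has a closed complement containing [A] but not [x].
    Conversely, a closed superset of [A] missing [x] has an open complement, which contains a ball
    around [x] disjoint from [A]. *)
Lemma closureE c A x : is_closure X T c A -> A ⊆ X ->
  x ∈ c <-> x ∈ X /\ forall r, 0 < r -> exists y, y ∈ A /\ D x y < r.
Proof.
move=> Hc AX; rewrite Hc; split=> -[xX H]; split=> //; [move=> r r0|move=> F [FX cF] AF].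
  apply: contrapT => nA.
  have dF : definable (fun e => ~ D x (e O) < r) by definability.
  pose F := sep X (fun y => ~ D x y < r).
  have inF y : y ∈ F <-> y ∈ X /\ ~ D x y < r by rewrite mem_sep.
  have : x ∈ F.
    apply: H; last first.
      move=> y yA; apply/inF; split=> [|xy]; first exact: AX.
      by apply: nA; exists y.
    split=> [y /inF [] //|U HU].
    have -> : U = sep X (fun y => D x y < r).
      apply: set_ext => y; rewrite HU inF mem_sep; last definability.
      split=> -[yX Hy]; split=> //; last by case.
      by apply: contrapT => nxy; apply: Hy.
    apply: metric_openI; first by definability.
    move=> y yX xy; exists (r - D x y); split=> [|z zX yz]; first lra.
    have := is_metric_triangle DM xX yX zX; lra.
  move=> /inF [_ ]; apply; suff -> : D x x = 0 by [].
  exact/(is_metric_eq0 DM xX xX).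
apply: contrapT => nxF.
have dU : definable (fun e => ~ e O ∈ F) by definability.
have /DT [_ UO] : sep X (fun y => ~ y ∈ F) ∈ T.
  by apply: cF => y; rewrite mem_sep.
have [|r [r0 Hr]] := UO x; first by rewrite mem_sep.
have [y [yA xy]] := H r r0.
have := Hr y (AX _ yA) xy; rewrite mem_sep // => -[_]; apply; exact: AF.
Qed.

End Closure.

Lemma closure_exists (X T A : V) : exists c, is_closure X T c A.
Proof.
exists (sep X (fun x => forall C, closed X T C -> A ⊆ C -> x ∈ C)) => x.
by rewrite mem_sep //; rewrite /closed /is_diff /comprises; definability.
Qed.

Lemma interior_exists (X T A : V) : topology X T -> exists i, is_interior T i A.
Proof.
move=> tT; exists (sep A (fun x => exists U, U ∈ T /\ U ⊆ A /\ x ∈ U)) => x.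
rewrite mem_sep; last by definability.
by split=> [[]//|[U [UT [UA xU]]]]; split; [exact: UA|exists U].
Qed.

Section Forward.
Variables (X T B : V) (D : V -> V -> real).
Hypotheses (tT : topology X T) (dD : definable_fun2 (fun x y => rval (D x y)))
  (DM : is_metric X D) (DT : forall U, U ∈ T <-> metric_open X D U)
  (inB : forall A, A ∈ B <-> A ⊆ X /\ bounded D A).

Lemma metrizable_proper : proper_universe X T B.
Proof.
move=> A /inB [AX [r Hr]].
pose P y := exists a, a ∈ A /\ D a y < 1.
have dP : definable (fun e => P (e O)) by rewrite /P; definability.
have inC y : y ∈ sep X P <-> y ∈ X /\ P y by rewrite mem_sep.
have CT : sep X P ∈ T.
  apply: (metric_openI DT dP) => x xX [a [aA ax]].
  exists (1 - D a x); split=> [|y yX xy]; first lra.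
  exists a; split=> //; have := is_metric_triangle DM (AX _ aA) xX yX; lra.
have [c Hc] := closure_exists X T A.
have [i Hi] := interior_exists (sep X P) tT.
exists (sep X P), c, i; split; last first.
  split=> //; split=> // x; rewrite (closureE dD DM DT _ Hc AX) Hi => -[xX Hx].
  exists (sep X P); split=> //; split=> //; apply/inC; split=> //.
  have [y [yA xy]] := Hx 1 ltr01; exists y; split=> //.
  by rewrite (is_metric_sym DM) //; exact: AX.
apply/inB; split=> [y /inC []//|].
(* The path from [x] to [y] runs through the nearby points [a] and [b] of [A]. *)
exists (1 + r + 1) => x y /inC [xX [a [aA ax]]] /inC [yX [b [bA by_]]].
have := is_metric_triangle DM xX (AX _ aA) yX.
have := is_metric_triangle DM (AX _ aA) (AX _ bA) yX.
rewrite (is_metric_sym DM xX (AX _ aA)); have := Hr _ _ aA bA; lra.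
Qed.

Lemma metrizable_countable_base : has_countable_base B.
Proof.
(* The centre of the balls: a point of [X] if there is one, and an arbitrary set otherwise. *)
have [o Ho] : exists o, forall y, y ∈ X -> o ∈ X.
  case: (lem (exists o, o ∈ X)) => [[o oX]|nX]; first by exists o.
  by exists void => y yX; case: nX; exists y.
pose F n := sep X (fun y => D o y < natr n).
have inF n y : y ∈ F n <-> y ∈ X /\ D o y < natr n.
  by rewrite mem_sep //; definability.
have dF : definable_fun F by apply: definable_funE; rewrite /F; definability.
pose Q := sep (pow X) (fun A => exists n, n ∈ omega /\ A = F n).
have inQ A : A ∈ Q <-> exists n, n ∈ omega /\ A = F n.
  rewrite mem_sep; last by definability.
  split=> [[]//|[n [nw ->]]]; split; last by exists n.
  by apply/in_pow => y /inF [].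
exists Q; split; last exact: (countable_image dF inQ).
split=> [A /inQ [n [nw ->]]|C /inB [CX [r Hr]]].
  apply/inB; split=> [y /inF []//|].
  exists (natr n + natr n) => x y /inF [xX ox] /inF [yX oy].
  have oX := Ho _ xX.
  have := is_metric_triangle DM xX oX yX; rewrite (is_metric_sym DM xX oX); lra.
(* An empty [C] offers no point to measure from, but any base member contains it. *)
case: (lem (exists a, a ∈ C)) => [[a aC]|nC]; last first.
  exists (F void); split; first by apply/inQ; exists void; split=> //; exact: void_omega.
  by move=> y yC; case: nC; exists y.
have [n [nw Hn]] := natr_archi (D o a + r).
exists (F n); split; first by apply/inQ; exists n.
move=> y yC; apply/inF; split; first exact: CX.
have := is_metric_triangle DM (Ho _ (CX _ aC)) (CX _ aC) (CX _ yC).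
have := Hr _ _ aC yC; lra.
Qed.

End Forward.

(** * A continuous gauge of the bornology *)

Section Backward.
Variables (X T B : V) (D : V -> V -> real).
Hypotheses (dD : definable_fun2 (fun x y => rval (D x y)))
  (DM : is_metric X D) (DT : forall U, U ∈ T <-> metric_open X D U)
  (tT : topology X T) (bB : bornology X B).

Section Gauge.
(** Here [inner r] stands for the distance to [E r], [outer r] for the distance to the complement of
    [E (cap r)], and [cap] for the monotone radius supplied by properness. The construction of the
    gauge is carried out from the listed properties alone. *)
Variables (E : real -> V) (inner outer : real -> V -> real) (cap : real -> real).
Hypotheses (d_inner : forall (s : (nat -> V) -> real) t,
    definable_term (fun e => rval (s e)) -> definable_term t ->
    definable_term (fun e => rval (inner (s e) (t e))))
  (d_outer : forall (s : (nat -> V) -> real) t,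
    definable_term (fun e => rval (s e)) -> definable_term t ->
    definable_term (fun e => rval (outer (s e) (t e))))
  (E_born : forall r, E r ∈ B)
  (E_mono : forall q r, q <= r -> E q ⊆ E r)
  (E_ge0 : forall r x, x ∈ E r -> 0 <= r)
  (E_cofinal : forall A, A ∈ B -> exists r, A ⊆ E r)
  (cap_ge0 : forall r, 0 <= cap r)
  (inner_ge0 : forall r x, x ∈ X -> 0 <= inner r x)
  (outer_ge0 : forall r x, x ∈ X -> 0 <= outer r x)
  (inner_anti : forall q r x, x ∈ X -> q <= r -> inner r x <= inner q x)
  (outer_mono : forall q r x, x ∈ X -> q <= r -> outer q x <= outer r x)
  (inner_lip : forall r x y, x ∈ X -> y ∈ X -> inner r x <= inner r y + D x y)
  (outer_lip : forall r x y, x ∈ X -> y ∈ X -> outer r x <= outer r y + D x y)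
  (inner_mem : forall r x, x ∈ E r -> inner r x = 0)
  (inner_eq0_ge0 : forall r x, x ∈ X -> inner r x = 0 -> 0 <= r)
  (outer_gt0_mem : forall r x, x ∈ X -> 0 < outer r x -> x ∈ E (cap r))
  (outer_gt0 : forall r x, x ∈ X -> inner (r + 1) x = 0 -> 0 < outer r x).

Hint Extern 1 (definable_term (fun e => rval (inner (@?s e) (@?t e)))) =>
  apply: (@d_inner s t); cbv beta : definable.
Hint Extern 1 (definable_term (fun e => rval (outer (@?s e) (@?t e)))) =>
  apply: (@d_outer s t); cbv beta : definable.

Let EX r : E r ⊆ X. Proof. exact: (born_sub bB). Qed.

Definition urysohn r x := inner r x / (inner r x + outer r x).

Lemma cofinal_mem x : x ∈ X -> exists r, x ∈ E r.
Proof.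
move=> xX.
have /E_cofinal [r xr] : upair x x ∈ B.
  by apply: (born_singleton bB xX) => y; rewrite in_upair.
by exists r; apply: xr; apply/in_upair; left.
Qed.

(* Below the infimum of the [r] with [inner r x = 0], [inner] is bounded away
   from [0] by monotonicity; above it, [outer] is. *)
Lemma separation_gap x : x ∈ X ->
  exists k, 0 < k /\ forall r, k <= inner r x + outer r x.
Proof.
move=> xX; have [r0 xr0] := cofinal_mem xX.
have [|||inf_le le_inf] := @real_infP (fun r => inner r x = 0).
- by definability.
- by exists r0; exact: inner_mem.
- by exists 0 => r; exact: inner_eq0_ge0.
move: (real_inf _) inf_le le_inf => L inf_le le_inf.
have Lhalf : (L + 2^-1 <= L) = false by apply/negbTE; rewrite -ltNge; lra.
have [u [iu ou]] : exists u : real, 0 < inner u x /\ 0 < outer u x.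
  (* This radius lies below the infimum [L], so [inner] is positive there. Adding 1 passes above
     [L], where [inner] vanishes, so [outer_gt0] applies. *)
  exists (L - 2^-1); split.
    rewrite lt_neqAle inner_ge0 // andbT; apply/eqP => /esym /inf_le; lra.
  apply: outer_gt0 => //; apply: contrapT => i0.
  suff : L + 2^-1 <= L by rewrite Lhalf.
  apply: le_inf => r ir; rewrite leNgt; apply/negP => rL; apply: i0.
  have le_r : r <= L - 2^-1 + 1 by clear ir; lra.
  apply/le_anti/andP; split; last exact: inner_ge0.
  by rewrite -ir; exact: inner_anti.
exists (Order.min (inner u x) (outer u x)); split; first by rewrite lt_min iu.
move=> r; rewrite ge_min; apply/orP; case: (lerP r u) => [ru|/ltW ur].
  by left; have := inner_anti xX ru; have := outer_ge0 r xX; lra.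
by right; have := outer_mono xX ur; have := inner_ge0 r xX; lra.
Qed.

Lemma separation_gt0 r x : x ∈ X -> 0 < inner r x + outer r x.
Proof. by move=> /separation_gap [k [k0 /(_ r)]]; lra. Qed.

Lemma urysohn_le1 r x : x ∈ X -> urysohn r x <= 1.
Proof.
move=> xX; rewrite ler_pdivrMr ?separation_gt0 // mul1r.
by rewrite lerDl outer_ge0.
Qed.

Lemma urysohn_mem r x : x ∈ E r -> urysohn r x = 0.
Proof. by move=> xE; rewrite /urysohn inner_mem // mul0r. Qed.

Lemma urysohn_lt1_mem r x : x ∈ X -> urysohn r x < 1 -> x ∈ E (cap r).
Proof.
move=> xX; rewrite ltr_pdivrMr ?separation_gt0 // mul1r ltrDl.
exact: outer_gt0_mem.
Qed.

Definition gauge x : real :=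
  real_sup (fun q => exists r, 0 <= r /\ q = r * urysohn r x).

Lemma definable_gauge : definable_fun (fun x => rval (gauge x)).
Proof.
by apply: definable_funE; rewrite /gauge /urysohn; definability.
Qed.

(** For [r >= m] the Urysohn function vanishes on [E m], since [E m] is contained in [E r]; for
    [r <= m] it is at most 1. So the supremum defining the gauge is finite, and it is at most [m] on
    [E m]. *)
Lemma urysohn_bound m r x : x ∈ E m -> 0 <= r -> r * urysohn r x <= m.
Proof.
move=> xE r0.
have m0 := E_ge0 xE.
case: (lerP m r) => [mr|/ltW rm].
  by rewrite urysohn_mem ?mulr0 //; exact: E_mono xE.
apply: le_trans rm; rewrite ler_piMr //; apply: urysohn_le1; exact: EX xE.
Qed.

Let gauge_sup x : x ∈ X ->
  is_real_sup (fun q => exists r, 0 <= r /\ q = r * urysohn r x) (gauge x).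
Proof.
move=> xX; apply: real_supP.
- by rewrite /urysohn; definability.
- by exists 0, 0; rewrite mul0r.
- have [m xm] := cofinal_mem xX; exists m => q [r [r0 ->]].
  exact: urysohn_bound.
Qed.

#[local] Opaque gauge.

Lemma gauge_ge r x : x ∈ X -> 0 <= r -> r * urysohn r x <= gauge x.
Proof. by move=> xX r0; apply: (gauge_sup xX).1; exists r. Qed.

Lemma gauge_le (b : real) x : x ∈ X -> (forall r, 0 <= r -> r * urysohn r x <= b) ->
  gauge x <= b.
Proof. by move=> xX H; apply: (gauge_sup xX).2 => q [r [r0 ->]]; exact: H. Qed.

Lemma gauge_ge0 x : x ∈ X -> 0 <= gauge x.
Proof. by move=> xX; rewrite -[0](mul0r (urysohn 0 x)); exact: gauge_ge. Qed.

Lemma gauge_le_mem m x : x ∈ E m -> gauge x <= m.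
Proof.
move=> xE; apply: gauge_le => [|r r0]; first exact: EX xE.
exact: urysohn_bound.
Qed.

(** From [r * urysohn r x <= gauge x < r] it follows that the Urysohn function is below 1 at [x]. *)
Lemma gauge_lt_mem r x : x ∈ X -> 0 < r -> gauge x < r -> x ∈ E (cap r).
Proof.
move=> xX r0 lt_r; apply: urysohn_lt1_mem => //.
by rewrite -(ltr_pM2l r0) mulr1; apply: le_lt_trans lt_r; apply: gauge_ge => //; exact: ltW.
Qed.

Lemma gauge_born A : A ⊆ X -> A ∈ B <-> exists r, forall x, x ∈ A -> gauge x <= r.
Proof.
move=> AX; split=> [/E_cofinal [m Am]|[r Hr]].
  by exists m => x /Am; exact: gauge_le_mem.
(* The index [|r| + 1] is positive and strictly exceeds all values of the gauge on [A], as
   [gauge_lt_mem] demands. *)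
apply: (born_down bB (E_born (cap (`|r| + 1)))) => x xA.
have r0 := normr_ge0 r; have rr := ler_norm r; have := Hr x xA => xr.
by apply: gauge_lt_mem; [exact: AX|lra|lra].
Qed.

(** Only indices up to [m] matter at a point of [E m]. For these, [ratio_lip] bounds the increase of
    the Urysohn function by [D x y / k], and the factor [r] is at most [m]. *)
Lemma gauge_lip (m k : real) x y : x ∈ X -> y ∈ E m -> 0 < k ->
  (forall r, k <= inner r x + outer r x) ->
  (forall r, k <= inner r y + outer r y) ->
  gauge y <= gauge x + m * (D x y / k).
Proof.
move=> xX ym k0 kx ky; have yX := EX ym.
have m0 := E_ge0 ym.
have Dk0 : 0 <= D x y / k by rewrite divr_ge0 ?(is_metric_ge0 DM) // ltW.
apply: gauge_le => // r r0; case: (lerP m r) => [mr|/ltW rm].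
  rewrite (urysohn_mem (E_mono mr ym)) mulr0.
  by apply: addr_ge0; [exact: gauge_ge0|exact: mulr_ge0].
have : urysohn r y <= urysohn r x + D x y / k.
  apply: (ratio_lip k0 (inner_ge0 r xX) (outer_ge0 r xX) (ky r) (kx r)).
  - by rewrite (is_metric_sym DM xX yX); exact: inner_lip.
  - exact: outer_lip.
  - exact: (is_metric_ge0 DM xX yX).
move=> /(ler_wpM2l r0) ury; apply: (le_trans ury); rewrite mulrDr.
exact: (lerD (gauge_ge xX r0) (ler_wpM2r Dk0 rm)).
Qed.

Lemma gauge_continuous x e : x ∈ X -> 0 < e -> exists r, 0 < r /\
  forall y, y ∈ X -> D x y < r -> `|gauge x - gauge y| < e.
Proof.
move=> xX e0.
have [r0 xr0] := cofinal_mem xX.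
have o0 : 0 < outer r0 x.
  by apply: outer_gt0 => //; apply/inner_mem/(E_mono _ xr0); lra.
(* Since [outer r0] is Lipschitz and positive at [x], all points near [x] lie in the single set
   [E m], so one [m] serves in both directions of the estimate. *)
set m := cap r0.
have inEm y : y ∈ X -> D x y < outer r0 x -> y ∈ E m.
  by move=> yX xy; apply: outer_gt0_mem => //; have := outer_lip r0 xX yX; lra.
have [k [k0 kx]] := separation_gap xX.
have m0 : 0 <= m := cap_ge0 r0.
have k2 : 0 < k / 2 by lra.
have k4 : 0 < k / 4 by lra.
have [q [q0 Hq]] := small_radius m0 k2 e0.
(* The first bound keeps [y] in [E m]. Within [k / 4], the terms [inner] and [outer] drop by at most
   [k / 4] each, so the denominators stay above [k / 2]. The radius [q] makes the Lipschitz estimate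
   smaller than [e]. *)
exists (Order.min (outer r0 x) (Order.min (k / 4) q)).
split; first by apply/lt_minP; split=> //; apply/lt_minP.
move=> y yX /lt_minP [xyo /lt_minP [xyk xyq]].
have kx2 r : k / 2 <= inner r x + outer r x by have := kx r; lra.
have ky2 r : k / 2 <= inner r y + outer r y.
  have := kx r; have := inner_lip r xX yX; have := outer_lip r xX yX; lra.
have h1 := gauge_lip xX (inEm y yX xyo) k2 kx2 ky2.
have h2 := gauge_lip yX (outer_gt0_mem xX o0) k2 ky2 kx2.
rewrite (is_metric_sym DM yX xX) in h2.
have small : m * (D x y / (k / 2)) < e.
  apply: le_lt_trans Hq; apply: (ler_wpM2l m0).
  by apply: ler_wpM2r; [rewrite invr_ge0; exact: ltW|exact: ltW].
exact: norm_sub_lt small h1 h2.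
Qed.

Lemma gauge_exists : exists F : V -> real,
  [/\ definable_fun (fun x => rval (F x)), forall x, x ∈ X -> 0 <= F x,
      forall A, A ⊆ X -> A ∈ B <-> exists r, forall x, x ∈ A -> F x <= r &
      forall x e, x ∈ X -> 0 < e -> exists r, 0 < r /\
        forall y, y ∈ X -> D x y < r -> `|F x - F y| < e].
Proof.
exists gauge; split.
- exact: definable_gauge.
- exact: gauge_ge0.
- exact: gauge_born.
- exact: gauge_continuous.
Qed.

End Gauge.

(** * Distances to sets *)

(* Capped at [1], so that it is also defined for [S] empty. *)
Definition dist S x : real :=
  real_inf (fun r => r = 1 \/ exists y, y ∈ S /\ r = D x y).

Lemma definable_dist s t : definable_term s -> definable_term t ->
  definable_term (fun e => rval (dist (s e) (t e))).
Proof.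
move=> ds dt; apply: (definable_fun2E (F := fun S x => rval (dist S x))) => //.
by rewrite /dist; definability.
Qed.
Hint Extern 1 (definable_term (fun e => rval (dist (@?s e) (@?t e)))) =>
  apply: (@definable_dist s t); cbv beta : definable.

Section Dist.
Variables (S x : V).
Hypotheses (SX : S ⊆ X) (xX : x ∈ X).

Let dist_inf :
  (forall r, r = 1 \/ (exists y, y ∈ S /\ r = D x y) -> dist S x <= r) /\
  (forall b : real, (forall r, r = 1 \/ (exists y, y ∈ S /\ r = D x y) -> b <= r) ->
     b <= dist S x).
Proof.
apply: real_infP; first by definability.
  by exists 1; left.
exists 0 => r [->|[y [yS ->]]]; first exact: ler01.
by apply: (is_metric_ge0 DM) => //; exact: SX.
Qed.

Lemma dist_le1 : dist S x <= 1.
Proof. by apply: dist_inf.1; left. Qed.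

Lemma dist_le y : y ∈ S -> dist S x <= D x y.
Proof. by move=> yS; apply: dist_inf.1; right; exists y. Qed.

Lemma dist_lower (b : real) :
  b <= 1 -> (forall y, y ∈ S -> b <= D x y) -> b <= dist S x.
Proof. by move=> b1 bS; apply: dist_inf.2 => r [->|[y [yS ->]]] //; exact: bS. Qed.

Lemma dist_ge0 : 0 <= dist S x.
Proof.
apply: dist_lower => [|y yS]; first exact: ler01.
by apply: (is_metric_ge0 DM) => //; exact: SX.
Qed.

Lemma dist_mem : x ∈ S -> dist S x = 0.
Proof.
move=> xS; apply/le_anti; rewrite dist_ge0 andbT.
have -> : 0 = D x x by apply/esym/(is_metric_eq0 DM).
exact: dist_le.
Qed.

Lemma dist_gt0_notin : 0 < dist S x -> ~ x ∈ S.
Proof. by move=> d0 /dist_mem E; move: d0; rewrite E ltxx. Qed.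

Lemma dist_eq0_near r : dist S x = 0 -> 0 < r -> exists y, y ∈ S /\ D x y < r.
Proof.
move=> d0 r0; apply: contrapT => nS.
have : Order.min r 1 <= dist S x.
  apply: dist_lower => [|y yS]; first by rewrite ge_min lexx orbT.
  rewrite ge_min; apply/orP; left; rewrite leNgt; apply/negP => xy.
  by apply: nS; exists y.
by rewrite d0 leNgt lt_min r0 ltr01.
Qed.

End Dist.

Lemma dist_lip S x z : S ⊆ X -> x ∈ X -> z ∈ X -> dist S x <= dist S z + D x z.
Proof.
move=> SX xX zX; rewrite -lerBlDr; apply: dist_lower => // [|y yS].
  have := dist_le1 SX xX; have := is_metric_ge0 DM xX zX; lra.
have := dist_le SX xX yS; have := is_metric_triangle DM xX zX (SX _ yS); lra.
Qed.

Lemma dist_anti S S' x : S ⊆ S' -> S' ⊆ X -> x ∈ X -> dist S' x <= dist S x.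
Proof.
move=> SS' SX' xX; have SX : S ⊆ X by move=> y /SS' /SX'.
apply: dist_lower => // [|y yS]; first exact: dist_le1.
by apply: dist_le => //; exact: SS'.
Qed.

#[local] Opaque dist.

(** * A monotone absorption radius *)

Section Absorber.
Variable E : real -> V.
Hypotheses (dE : definable_fun (fun x => E (to_real x)))
  (E_born : forall r, E r ∈ B)
  (E_mono : forall q r, q <= r -> E q ⊆ E r)
  (E_ge0 : forall r x, x ∈ E r -> 0 <= r)
  (E_cofinal : forall A, A ∈ B -> exists r, A ⊆ E r)
  (prop : forall A, A ∈ B -> exists C, C ∈ B /\ forall x, x ∈ X ->
     (forall r, 0 < r -> exists y, y ∈ A /\ D x y < r) ->
     exists r, 0 < r /\ forall y, y ∈ X -> D x y < r -> y ∈ C).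

Let EX r : E r ⊆ X. Proof. exact: (born_sub bB). Qed.

Let definable_E (t : (nat -> V) -> real) :
  definable_term (fun e => rval (t e)) -> definable_term (fun e => E (t e)).
Proof.
move=> dt; have := dE dt.
by rewrite (_ : (fun e => E (to_real (rval (t e)))) = fun e => E (t e)) //;
   apply/funext => e; rewrite rvalK.
Qed.
Hint Extern 1 (definable_term (fun e => E (@?t e))) =>
  apply: (@definable_E t); cbv beta : definable.

Definition outside r := sep X (fun x => ~ x ∈ E r).

Lemma in_outside r x : x ∈ outside r <-> x ∈ X /\ ~ x ∈ E r.
Proof. by rewrite mem_sep //; definability. Qed.

Lemma outsideX r : outside r ⊆ X.
Proof. by move=> x /in_outside []. Qed.

Lemma outside_anti q r : q <= r -> outside r ⊆ outside q.
Proof. by move=> qr x /in_outside [xX nx]; apply/in_outside; split=> // /(E_mono qr). Qed.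

Let definable_outside (t : (nat -> V) -> real) :
  definable_term (fun e => rval (t e)) -> definable_term (fun e => outside (t e)).
Proof.
move=> dt; have dt1 := definable_term_shift dt; rewrite /outside; definability.
Qed.
Hint Extern 1 (definable_term (fun e => outside (@?t e))) =>
  apply: (@definable_outside t); cbv beta : definable.
#[local] Opaque outside.

(** In terms of distances, the closure of [E (r + 1)] lies in the interior of [E q]. The condition
    [0 <= q] bounds the admissible radii below, so that their infimum exists. *)
Definition absorbs r q : Prop :=
  0 <= q /\ forall x, x ∈ X -> dist (E (r + 1)) x = 0 -> 0 < dist (outside q) x.

Lemma absorbs_mono r q q' : q <= q' -> absorbs r q -> absorbs r q'.
Proof.
move=> qq' [q0 H]; split=> [|x xX /(H x xX) lt0]; first exact: le_trans qq'.
by apply: (lt_le_trans lt0); exact: dist_anti (outside_anti qq') (@outsideX _) xX.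
Qed.

Lemma absorbs_anti r r' q : r <= r' -> absorbs r' q -> absorbs r q.
Proof.
move=> rr' [q0 H]; split=> [|x xX d0]; first exact: q0.
have le_r : r + 1 <= r' + 1 by lra.
apply: (H x xX); apply/le_anti/andP; split; last exact: dist_ge0 (@EX _) xX.
by rewrite -[X in _ <= X]d0; apply: dist_anti (E_mono le_r) (@EX _) xX.
Qed.

Lemma absorbs_exists r : exists q, absorbs r q.
Proof.
have [C [CB HC]] := prop (E_born (r + 1)).
have [q Cq] := E_cofinal CB.
exists (`|q|); split=> [|x xX d0]; first exact: normr_ge0.
have [|e [e0 He]] := HC x xX; first by move=> e; exact: dist_eq0_near.
(* The minimum with 1 is forced by the cap in [dist]. *)
apply: (@lt_le_trans _ _ (Order.min e 1)); first by rewrite lt_min e0 ltr01.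
apply: dist_lower => // [|| y /in_outside [yX ny]].
- exact: outsideX.
- by rewrite ge_min lexx orbT.
- rewrite ge_min; apply/orP; left; rewrite leNgt; apply/negP => xy.
  by apply: ny; apply: (E_mono (ler_norm q)); apply/Cq/He.
Qed.

(* The infimum of the admissible radii need not be admissible, hence [+ 1]. *)
Definition absorber r : real := real_inf (absorbs r) + 1.

Let definable_absorber (t : (nat -> V) -> real) :
  definable_term (fun e => rval (t e)) ->
  definable_term (fun e => rval (absorber (t e))).
Proof.
move=> dt; have dt2 := definable_term_shift (definable_term_shift dt).
rewrite /absorber /absorbs; definability.
Qed.
Hint Extern 1 (definable_term (fun e => rval (absorber (@?t e)))) =>
  apply: (@definable_absorber t); cbv beta : definable.

Let absorber_inf r : (forall q, absorbs r q -> real_inf (absorbs r) <= q) /\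
  (forall b : real, (forall q, absorbs r q -> b <= q) -> b <= real_inf (absorbs r)).
Proof.
apply: real_infP; first by rewrite /absorbs; definability.
  exact: absorbs_exists.
by exists 0 => q [].
Qed.

(** Admissible radii are closed upwards. If the infimum plus 1 were not admissible, it would be a
    lower bound of the admissible radii and hence at most their infimum. *)
Lemma absorberP r : absorbs r (absorber r).
Proof.
apply: contrapT => nabs.
suff : real_inf (absorbs r) + 1 <= real_inf (absorbs r) by lra.
apply: (absorber_inf r).2 => q abs_q; rewrite leNgt; apply/negP => lt_q.
by apply: nabs; apply: absorbs_mono abs_q; exact: ltW.
Qed.

(** A larger index has fewer admissible radii by [absorbs_anti], so the infimum can only grow. *)
Lemma absorber_mono q r : q <= r -> absorber q <= absorber r.
Proof.
move=> qr; rewrite lerD2r; apply: (absorber_inf r).2 => u abs_u.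
by apply: (absorber_inf q).1; exact: absorbs_anti abs_u.
Qed.
#[local] Opaque absorber.

Definition inner r x := dist (E r) x.
Definition outer r x := dist (outside (absorber r)) x.
Let inner_ge0 r x : x ∈ X -> 0 <= inner r x.
Proof. exact: dist_ge0. Qed.

Let outer_ge0 r x : x ∈ X -> 0 <= outer r x.
Proof. by apply: dist_ge0; exact: outsideX. Qed.

Let inner_anti q r x : x ∈ X -> q <= r -> inner r x <= inner q x.
Proof. by move=> xX /E_mono qr; apply: dist_anti. Qed.

Let outer_mono q r x : x ∈ X -> q <= r -> outer q x <= outer r x.
Proof.
move=> xX /absorber_mono qr.
exact: dist_anti (outside_anti qr) (@outsideX _) xX.
Qed.

Let inner_lip r x y : x ∈ X -> y ∈ X -> inner r x <= inner r y + D x y.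
Proof. exact: dist_lip. Qed.

Let outer_lip r x y : x ∈ X -> y ∈ X -> outer r x <= outer r y + D x y.
Proof. by apply: dist_lip; exact: outsideX. Qed.

Let inner_mem r x : x ∈ E r -> inner r x = 0.
Proof. by move=> xE; apply: dist_mem => //; exact: EX xE. Qed.

Let outer_gt0_mem r x : x ∈ X -> 0 < outer r x -> x ∈ E (absorber r).
Proof.
move=> xX /(dist_gt0_notin (@outsideX _) xX) nx; apply: contrapT => nE.
by apply: nx; apply/in_outside.
Qed.

Let inner_eq0_ge0 r x : x ∈ X -> inner r x = 0 -> 0 <= r.
Proof.
move=> xX i0; have [y [/E_ge0]] := dist_eq0_near (@EX r) xX i0 ltr01.
by [].
Qed.

Let outer_gt0 r x : x ∈ X -> inner (r + 1) x = 0 -> 0 < outer r x.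
Proof. by move=> xX; apply: (absorberP r).2. Qed.

Lemma absorber_gauge_exists : exists F : V -> real,
  [/\ definable_fun (fun x => rval (F x)), forall x, x ∈ X -> 0 <= F x,
      forall A, A ⊆ X -> A ∈ B <-> exists r, forall x, x ∈ A -> F x <= r &
      forall x e, x ∈ X -> 0 < e -> exists r, 0 < r /\
        forall y, y ∈ X -> D x y < r -> `|F x - F y| < e].
Proof.
apply: (@gauge_exists E inner outer absorber) => //.
- by rewrite /inner => s t ds dt; definability.
- by rewrite /outer => s t ds dt; definability.
- by move=> r; have [] := absorberP r.
Qed.

End Absorber.

(** * A real-indexed filtration of the bornology from a countable base *)

Lemma countable_base_filtration : has_countable_base B -> exists E : real -> V,
  [/\ definable_fun (fun x => E (to_real x)), forall r, E r ∈ B,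
      forall q r, q <= r -> E q ⊆ E r, forall r x, x ∈ E r -> 0 <= r &
      forall A, A ∈ B -> exists r, A ⊆ E r].
Proof.
move=> [Q [[QB Qbase] [w [s [f [/is_omegaE -> [sw [/is_funE [fs ff] finj]]]]]]]].
pose code S := the (fun n => pair S n ∈ f).
have codeP S : S ∈ Q -> pair S (code S) ∈ f.
  by move=> /ff SQ; exact: (theP SQ).
have code_omega S : S ∈ Q -> code S ∈ omega.
  by move=> /codeP/fs; rewrite pair_in_cprod => -[_ /sw].
have code_inj S S' : S ∈ Q -> S' ∈ Q -> code S = code S' -> S = S'.
  move=> /codeP fS /codeP fS' E; rewrite -E in fS'.
  have /finj [S0 [_ u]] : code S ∈ s by move: (fs _ fS); rewrite pair_in_cprod => -[].
  by rewrite -(u S); [apply: u|]; apply/relE.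
have d_code : definable_fun code.
  by apply: definable_funE; rewrite /code; definability.
have born_void : void ∈ B.
  have [A AB] := born_nonvoid bB.
  by apply: (born_down bB AB) => y /in_void.
(* The union of the base members with code below [n]. It belongs to [B] by induction, because
   injectivity of the code lets each step add at most one base member. *)
pose G n := sep X (fun x => exists S, S ∈ Q /\ x ∈ S /\ code S ∈ n).
have inG n x : x ∈ G n <-> x ∈ X /\ exists S, S ∈ Q /\ x ∈ S /\ code S ∈ n.
  by rewrite mem_sep //; definability.
have G_born n : n ∈ omega -> G n ∈ B.
  move: n; apply: omega_ind.
  - by rewrite /G; definability.
  - suff -> : G void = void by [].
    by apply/empty_void => x /inG [_ [S [_ [_ /in_void]]]].
  move=> n nw Gn.
  suff [S [SB HS]] : exists S, S ∈ B /\ forall S', S' ∈ Q -> code S' = n -> S' ⊆ S.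
    have GSB : cup (G n) S ∈ B.
      by apply: (born_cup bB Gn SB) => x; rewrite in_cup.
    apply: (born_down bB GSB) => x /inG [xX [S' [S'Q [xS' /in_succ cS']]]].
    rewrite in_cup; case: cS' => [cS'|/(HS _ S'Q) S'S]; last by right; exact: S'S.
    by left; apply/inG; split=> //; exists S'.
  case: (lem (exists S, S ∈ Q /\ code S = n)) => [[S [SQ cS]]|nS].
    exists S; split=> [|S' S'Q cS' x]; first exact: QB.
    by rewrite (code_inj S' S) // cS' cS.
  by exists void; split=> // S' S'Q cS'; case: nS; exists S'.
(* Codes are compared as reals. Thus [E r] is empty for negative [r], and it is contained in [G n]
   as soon as [natr n] exceeds [r]. *)
pose E r := sep X (fun x => exists S, S ∈ Q /\ x ∈ S /\ natr (code S) <= r).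
have inE r x : x ∈ E r <-> x ∈ X /\ exists S, S ∈ Q /\ x ∈ S /\ natr (code S) <= r.
  by rewrite mem_sep //; definability.
exists E; split.
- by apply: definable_funE; rewrite /E; definability.
- move=> r; have [n [nw rn]] := natr_archi r.
  apply: (born_down bB (G_born n nw)) => x /inE [xX [S [SQ [xS le_r]]]].
  apply/inG; split=> //; exists S; split=> //; split=> //.
  by apply: natr_lt_mem => //; [exact: code_omega|exact: le_lt_trans rn].
- move=> q r qr x /inE [xX [S [SQ [xS le_q]]]]; apply/inE; split=> //.
  by exists S; split=> //; split=> //; exact: le_trans qr.
- move=> r x /inE [_ [S [SQ [_ le_r]]]]; apply: le_trans le_r.
  by apply: natr_ge0; exact: code_omega.
- move=> A AB; have [S [SQ AS]] := Qbase A AB.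
  exists (natr (code S)) => x xA; apply/inE; split; first exact: (born_sub bB AB).
  by exists S; split=> //; split; [exact: AS|].
Qed.

(** Properness with closure and interior expressed through [D], the form in which the absorption
    radius uses it. *)
Lemma proper_absorption : proper_universe X T B ->
  forall A, A ∈ B -> exists C, C ∈ B /\ forall x, x ∈ X ->
     (forall r, 0 < r -> exists y, y ∈ A /\ D x y < r) ->
     exists r, 0 < r /\ forall y, y ∈ X -> D x y < r -> y ∈ C.
Proof.
move=> prop A AB; have [C [c [i [CB [Hc [Hi ci]]]]]] := prop A AB.
exists C; split=> // x xX Hx.
have /ci : x ∈ c by apply/(closureE dD DM DT x Hc (born_sub bB AB)).
move=> /Hi [U [/DT [_ UO] [UC xU]]].
by have [r [r0 Hr]] := UO x xU; exists r; split=> // y yX xy; apply/UC/Hr.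
Qed.

(** * The metric that induces both the topology and the bornology *)

Section Remetrization.
Variable F : V -> real.
Hypotheses (dF : definable_fun (fun x => rval (F x)))
  (F_ge0 : forall x, x ∈ X -> 0 <= F x)
  (F_born : forall A, A ⊆ X -> A ∈ B <-> exists r, forall x, x ∈ A -> F x <= r)
  (F_cont : forall x e, x ∈ X -> 0 < e -> exists r, 0 < r /\
     forall y, y ∈ X -> D x y < r -> `|F x - F y| < e).

Definition remetric x y : real := Num.min (D x y) 1 + `|F x - F y|.

Lemma remetric_is_metric : is_metric X remetric.
Proof.
have [D0 D_eq0 Dsym Dtri] := DM.
split=> [x y xX yX|x y xX yX|x y xX yX|x y z xX yX zX].
- by apply: addr_ge0; [apply/le_minP; split=> //; exact: D0|exact: normr_ge0].
- split=> [D'0|<-]; last first.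
    rewrite /remetric; have -> : D x x = 0 by apply/D_eq0.
    by rewrite subrr normr0 addr0; exact: min_l ler01.
  apply/(D_eq0 x y xX yX); exact: min_add_norm_eq0 (D0 x y xX yX) D'0.
- by rewrite /remetric (Dsym x y xX yX) (distrC (F x)).
- exact: min_add_norm_triangle (D0 _ _ xX yX) (D0 _ _ yX zX) (Dtri _ _ _ xX yX zX).
Qed.

(** Continuity of [F] puts a [D]-ball inside every ball of the new metric; the truncated first
    summand gives the converse inclusion. *)
Lemma remetric_open U : metric_open X remetric U <-> metric_open X D U.
Proof.
split=> -[UX H]; split=> // x xU; have [r [r0 Hr]] := H x xU; have xX := UX x xU.
  have r20 : 0 < r / 2 by lra.
  have [e [e0 He]] := F_cont xX r20.
  exists (Num.min e (r / 2)); split; first exact/lt_minP.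
  move=> y yX /lt_minP [xye xyr]; apply: Hr => //.
  exact: min_add_lt xyr (He y yX xye).
exists (Num.min r 1); split; first by apply/lt_minP.
move=> y yX xy; apply: Hr => //; exact: min_add_norm_lt xy.
Qed.

(** The truncated summand contributes at most 1, so boundedness is decided by [F]. As [F] is
    nonnegative, an upper bound on [F] also bounds its differences. *)
Lemma remetric_bounded A : A ⊆ X -> A ∈ B <-> bounded remetric A.
Proof.
move=> AX; rewrite F_born //; split=> -[r Hr].
  exists (1 + r) => x y xA yA.
  exact: min_add_norm_le (F_ge0 (AX _ xA)) (F_ge0 (AX _ yA)) (Hr _ xA) (Hr _ yA).
case: (lem (exists a, a ∈ A)) => [[a aA]|nA]; last first.
  by exists 0 => x xA; case: nA; exists x.
exists (F a + r) => x xA.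
exact: min_add_norm_ge (is_metric_ge0 DM (AX _ xA) (AX _ aA)) (Hr _ _ xA aA).
Qed.

Lemma remetric_metrizable : metrizable_universe K X T B.
Proof.
have [|d [dM dE]] := metric_exists _ remetric_is_metric.
  by apply: definable_fun2E; rewrite /remetric; definability.
exists d; split=> //; split.
  apply/(induces_topologyE dM) => U; rewrite DT -remetric_open.
  split=> -[UX H]; split=> // x xU; have [r [r0 Hr]] := H x xU; exists r; split=> // y yX.
    by rewrite dE; [exact: Hr|exact: UX|].
  by rewrite -dE; [exact: Hr|exact: UX|].
move=> A; split=> [AB|[AX]].
  have AX := born_sub bB AB; split=> //; apply/(finite_diamE dM AX).
  have [r Hr] := (remetric_bounded AX).1 AB; exists r => x y xA yA.
  by rewrite dE; [exact: Hr|exact: AX|exact: AX].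
move=> /(finite_diamE dM AX) [r Hr]; apply/(remetric_bounded AX); exists r => x y xA yA.
by rewrite -dE; [exact: Hr|exact: AX|exact: AX].
Qed.

End Remetrization.

Lemma proper_metrizable : proper_universe X T B -> has_countable_base B ->
  metrizable_universe K X T B.
Proof.
move=> /proper_absorption prop /countable_base_filtration [E [dE E1 E2 E3 E4]].
have [F [dF F0 FB FC]] := absorber_gauge_exists dE E1 E2 E3 E4 prop.
exact: remetric_metrizable dF F0 FB FC.
Qed.

End Backward.

(** * The characterization of metrizable universes *)

Lemma metrizable_universeE (X T B : V) : bornological_universe X T B ->
  metrizable_universe K X T B <->
  (proper_universe X T B /\ metrizable_space K X T /\ has_countable_base B).
Proof.
have d_val d : definable_fun2 (fun x y => rval (fun2_val d x y)).
  by move=> s t ds dt; definability.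
move=> [tT bB]; split=> [[d [dM [dT dB]]]|[prop [[d [dM dT]] base]]]; last first.
  exact: proper_metrizable (d_val d) (metric_is_metric dM)
    ((induces_topologyE dM T).1 dT) bB prop base.
have inB A : A ∈ B <-> A ⊆ X /\ bounded (fun2_val d) A.
  by rewrite dB; split=> -[AX H]; split=> //; apply/(finite_diamE dM AX).
have DT := (induces_topologyE dM T).1 dT.
split.
  exact: metrizable_proper tT (d_val d) (metric_is_metric dM) DT inB.
split; first by exists d.
exact: metrizable_countable_base (d_val d) (metric_is_metric dM) inB.
Qed.

End Model.

Theorem corollary4p9 :
  forall (V : structure), ZF V ->
  forall (K : reals V), complete_ordered_field K ->
  forall (X T B : V), bornological_universe X T B ->
    metrizable_universe K X T B <->
    (proper_universe X T B /\ metrizable_space K X T /\ has_countable_base B).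
Proof. by move=> V hV K hK X T B; exact: metrizable_universeE hV K hK X T B. Qed.
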